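(* Let $f$ be a non-constant entire function which has only real zeros, has genus $0$ or $1$, and is real on the real axis. Then the points of ${\rm Fix}({\rm Aut}(f))$ are real, they are separated by the zeros of $f$, and the zeros of $f$ are separated by the points of ${\rm Fix}({\rm Aut}(f))$.
   Context: An automorphic function of $f$ is a (generally multivalued) analytic function $\phi$, or a branch of one, satisfying $f(\phi(z))=f(z)$, i.e. a branch of $f^{-1}\circ f$; ${\rm Aut}(f)$ is the group (under composition) of all of them, with identity ${\rm id}(z)=z$. ${\rm Fix}({\rm Aut}(f))=\bigcup_{\phi\in{\rm Aut}(f)-\{{\rm id}\}}\{w\in\mathbb{C}\,|\,\phi(w)=w\}$, the set of points fixed by some non-identity branch of $f^{-1}\circ f$.
   Formalization: Between two distinct points of Fix(Aut(f)) a zero of f is found in the closed interval they bound, not strictly between them: the strict form fails at multiple zeros, e.g. f = z²(z−1), where 0 and 2/3 are in Fix(Aut(f)) with no zero strictly between. *)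

(* Defs.v *)
(* The complex plane is  R[i]  (mathcomp-real-closed, R : realType), viewed as a
   normed module over itself via  (R[i])^o  so that limits / complex
   differentiability ( derivable f z 1 ) are available. *)
From mathcomp Require Import all_boot all_algebra.
From mathcomp Require Import all_classical all_reals all_analysis.
From mathcomp.real_closed Require Import complex.
Import GRing.Theory Num.Theory.
Import numFieldNormedType.Exports.

Set Implicit Arguments.
Unset Strict Implicit.
Unset Printing Implicit Defensive.

Local Open Scope ring_scope.
Local Open Scope classical_set_scope.

Section Defs.
Variable R : realType.
Local Notation C := ((R[i])^o).

Definition expC (z : C) : C :=
  Complex (expR (complex.Re z) * cos (complex.Im z)) (expR (complex.Re z) * sin (complex.Im z)).

Definition entire (f : C -> C) : Prop := forall z : C, derivable f z 1.

Definition holomorphic_on (D : set C) (f : C -> C) : Prop :=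
  forall z, D z -> derivable f z 1.

Definition domain (D : set C) : Prop := open D /\ connected D /\ D !=set0.

(* f has genus at most 1 (i.e. genus 0 or 1), in the sense of the Hadamard /
   Weierstrass representation (Ahlfors' definition of the genus):
     f(z) = c z^m e^{b z} prod_n (1 - r_n z) e^{r_n z},
   where the r_n = 1/a_n are the reciprocals of the non-zero zeros a_n of f
   (with multiplicity; r_n = 0 is allowed and gives the trivial factor 1,
   which accommodates finitely many zeros), sum |r_n|^2 < oo, c <> 0, and the
   infinite product converges (as the limit of its partial products). *)
Definition genus_le1 (f : C -> C) : Prop :=
  exists (c b : C) (m : nat) (r : nat -> C),
    c != 0 /\
    cvg (series (fun n => complex.Re (r n) ^+ 2 + complex.Im (r n) ^+ 2) @ \oo) /\
    forall z : C,
      (fun N : nat => c * z ^+ m * expC (b * z) *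
          \prod_(n < N) ((1 - r n * z) * expC (r n * z))) @ \oo --> f z.

(* phi is a branch, on the domain D, of f^{-1} o f, i.e. an element of Aut(f) *)
Definition aut_branch (f : C -> C) (D : set C) (phi : C -> C) : Prop :=
  domain D /\ holomorphic_on D phi /\ (forall z, D z -> f (phi z) = f z).

Definition FixAut (f : C -> C) : set C :=
  [set w | exists (D : set C) (phi : C -> C),
      [/\ aut_branch f D phi, D w,
          (exists2 z, D z & phi z != z) & phi w = w]].

End Defs.

(* Main.v *)
Require Import Defs.
From mathcomp Require Import all_boot all_order all_algebra.
From mathcomp Require Import all_classical all_reals all_analysis.
From mathcomp.real_closed Require Import complex.
From mathcomp Require Import ring lra.
Import Order.TTheory GRing.Theory Num.Theory.
Import numFieldNormedType.Exports.
Import Normc.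

(* A function f as in the theorem is c z^m e^(b z) prod (1 - r_n z) e^(r_n z) with real r_n, and
   its logarithmic derivative L exists off the zeros.  Multiplying out the product around a
   point w with f w <> 0 gives f (w + h) = f w (1 + L(w) h + O(h^2)) uniformly near w, and with
   s_n(w) = 1 / (a_n - w), a_n running over the zeros, Im L(w) = - Im w * sum |s_n(w)|^2 and
   L(x) - L(y) = (y - x) sum s_n(x) s_n(y).  Hence b is real, L vanishes only on the real line,
   and it is strictly decreasing between consecutive zeros (if there are no zeros, L = b <> 0).

   Where f and L do not vanish f is locally injective, so a branch phi of f^-1 o f fixing such a
   point is the identity nearby; since the exceptional points are real and the others are dense
   in the real line, this propagates along segments through the domain of phi.  So every
   point of Fix(Aut f) is a zero of f or of L, hence is real, and two of them are separated
   by a zero of f.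

   Conversely, between two zeros |f| has a positive maximum, at a point t with L(t) = 0 where
   f (t + u) - f (t + v) = (a + o(1)) (u - v) (u + v) with a <> 0; a contraction argument then
   solves f (t + v) = f (t + u) with v close to - u, and this v is a holomorphic branch. *)

Set Implicit Arguments.
Unset Strict Implicit.
Unset Printing Implicit Defensive.

Local Open Scope ring_scope.
Local Open Scope complex_scope.
Local Open Scope classical_set_scope.

(** * The real-valued modulus; limits and complex derivatives expressed through it *)

Section Modulus.
Variable R : realType.
Implicit Types x y z w : R[i].
Local Notation C := ((R[i])^o).

Lemma normc_ge0 z : 0 <= normc z.
Proof. by case: z => a b; exact: sqrtr_ge0. Qed.

Lemma normc_eq0 z : (normc z == 0) = (z == 0).
Proof. by apply/eqP/eqP => [/eq0_normc|->]; rewrite ?normc0. Qed.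

Lemma normc_gt0 z : (0 < normc z) = (z != 0).
Proof. by rewrite lt_def normc_ge0 andbT normc_eq0. Qed.

Lemma sqr_normcE z : normc z ^+ 2 = complex.Re z ^+ 2 + complex.Im z ^+ 2.
Proof. by case: z => a b /=; rewrite sqr_sqrtr // addr_ge0 // sqr_ge0. Qed.

Lemma normcD_le x y : normc (x + y) <= normc x + normc y.
Proof. exact: (@le_normcD R x y). Qed.

Lemma normc_opp x : normc (- x) = normc x.
Proof. exact: (@normcN R x). Qed.

Lemma normcB_sym x y : normc (x - y) = normc (y - x).
Proof. by rewrite -normc_opp opprB. Qed.

Lemma normcB_le x y : normc (x - y) <= normc x + normc y.
Proof. by rewrite -(normc_opp y); exact: normcD_le. Qed.

Lemma normc_dist_trans z x y : normc (x - y) <= normc (x - z) + normc (z - y).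
Proof. by have := normcD_le (x - z) (z - y); rewrite addrA subrK. Qed.

Lemma normcB_ge x y : normc x - normc y <= normc (x - y).
Proof. by have := normcD_le (x - y) y; rewrite subrK; lra. Qed.

Lemma normcD_ge x y : normc x - normc y <= normc (x + y).
Proof. by have := normcB_ge x (- y); rewrite opprK normc_opp. Qed.

Lemma normc_real (a : R) : normc a%:C = `|a|.
Proof. by rewrite /= expr0n addr0 sqrtr_sqr. Qed.

Lemma normc_Re z : `|complex.Re z| <= normc z.
Proof. by case: z => a b /=; rewrite -sqrtr_sqr ler_wsqrtr // lerDl sqr_ge0. Qed.

Lemma normc_Im z : `|complex.Im z| <= normc z.
Proof. by case: z => a b /=; rewrite -sqrtr_sqr ler_wsqrtr // lerDr sqr_ge0. Qed.

Lemma normc_le_ReIm z : normc z <= `|complex.Re z| + `|complex.Im z|.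
Proof.
rewrite -(@ler_pXn2r _ 2) ?nnegrE ?normc_ge0 ?addr_ge0 //.
rewrite sqr_normcE -(real_normK (num_real (complex.Re z))).
rewrite -(real_normK (num_real (complex.Im z))).
have := normr_ge0 (complex.Re z); have := normr_ge0 (complex.Im z); nra.
Qed.

Lemma normc_double z : normc (z + z) = 2 * normc z.
Proof.
have -> : z + z = (2 : R)%:C * z by rewrite rmorph_nat mulr_natl mulr2n.
by rewrite normcM normc_real ger0_norm.
Qed.

Lemma normcX z n : normc (z ^+ n) = normc z ^+ n.
Proof.
by elim: n => [|n IH]; rewrite ?expr0 ?normc1 // !exprS normcM IH.
Qed.

Lemma normc_div x y : normc (x / y) = normc x / normc y.
Proof. by rewrite normcM normcV. Qed.

Lemma normc_sum_le (F : nat -> R[i]) N :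
  normc (\sum_(n < N) F n) <= \sum_(n < N) normc (F n).
Proof.
elim: N => [|N IH]; first by rewrite !big_ord0 normc0.
by rewrite !big_ord_recr /=; apply: (le_trans (normcD_le _ _)); rewrite lerD2r.
Qed.

Lemma normcP_lt (z : R[i]) (e : R[i]) : 0 < e -> (`|z| < e) = (normc z < complex.Re e).
Proof.
case: e => a b; rewrite ltcE /= => /andP[/eqP-> _].
by rewrite /Num.norm /= ltcE /= eqxx.
Qed.

(** Balls of [C] have radii in [R[i]], but a positive element there has zero imaginary part; so real
    radii give the same neighbourhoods and all later estimates are real inequalities. *)
Lemma nbhs_normcP (z : C) (A : set C) :
  nbhs z A <-> exists2 e : R, 0 < e & forall y : C, normc (y - z) < e -> A y.
Proof.
split.
- move=> /nbhs_ballP[e /= e0 H]; exists (complex.Re e).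
    by move: e0; rewrite ltcE /= => /andP[].
  move=> y yz; apply: H; rewrite -ball_normE /= normcP_lt //.
  by rewrite normcB_sym.
- move=> [e e0 H]; apply/nbhs_ballP; exists e%:C => /=; first by rewrite ltcR.
  move=> y; rewrite -ball_normE /= normcP_lt ?ltcR //= => yz.
  by apply: H; rewrite normcB_sym.
Qed.

Lemma cvg_normcP (T : Type) (F : set_system T) (FF : Filter F) (u : T -> C) (l : C) :
  u @ F --> l <-> forall e : R, 0 < e -> \forall x \near F, normc (u x - l) < e.
Proof.
split=> [H e e0|H].
- have := H [set y | normc (y - l) < e]; apply.
  by apply/nbhs_normcP; exists e.
- move=> A /nbhs_normcP[e e0 HA].
  by apply: filterS (H e e0) => x; exact: HA.
Qed.

Lemma cvg_normc (u : nat -> C) (l : C) :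
  u @ \oo --> l -> (fun n => normc (u n)) @ \oo --> normc l.
Proof.
move=> /cvg_normcP H; apply/cvgrPdist_lt => e e0.
apply: filterS (H e e0) => n; apply: le_lt_trans.
rewrite ler_norml; have := normcB_ge l (u n); have := normcB_ge (u n) l.
by rewrite (normcB_sym l); lra.
Qed.

Lemma cvg_Re (u : nat -> C) (l : C) :
  u @ \oo --> l -> (fun n => complex.Re (u n)) @ \oo --> complex.Re l.
Proof.
move=> /cvg_normcP H; apply/cvgrPdist_lt => e e0.
apply: filterS (H e e0) => n; apply: le_lt_trans.
by rewrite normcB_sym; apply: le_trans (normc_Re _); case: (l) (u n) => [? ?] [].
Qed.

Lemma cvg_Im (u : nat -> C) (l : C) :
  u @ \oo --> l -> (fun n => complex.Im (u n)) @ \oo --> complex.Im l.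
Proof.
move=> /cvg_normcP H; apply/cvgrPdist_lt => e e0.
apply: filterS (H e e0) => n; apply: le_lt_trans.
by rewrite normcB_sym; apply: le_trans (normc_Im _); case: (l) (u n) => [? ?] [].
Qed.

Lemma cvg_complex (u : nat -> C) (a b : R) :
  (fun n => complex.Re (u n)) @ \oo --> a -> (fun n => complex.Im (u n)) @ \oo --> b ->
  u @ \oo --> (Complex a b : C).
Proof.
move=> /cvgrPdist_lt Ha /cvgrPdist_lt Hb; apply/cvg_normcP => e e0.
have e2 : 0 < e / 2 by rewrite divr_gt0.
near=> n.
have h1 : `|a - complex.Re (u n)| < e / 2 by near: n; exact: Ha.
have h2 : `|b - complex.Im (u n)| < e / 2 by near: n; exact: Hb.
rewrite normcB_sym; apply: le_lt_trans (normc_le_ReIm _) _.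
case: (u n) h1 h2 => c d /=; lra.
Unshelve. all: by end_near. Qed.

Lemma derivable_normcP (f : C -> C) (z : C) :
  derivable f z 1 <-> exists d : C, forall e : R, 0 < e -> exists2 r : R, 0 < r &
    forall h : C, h != 0 -> normc h < r -> normc (h^-1 * (f (z + h) - f z) - d) < e.
Proof.
split.
- move=> /cvg_ex[d /cvg_normcP H]; exists d => e e0.
  have /= := H e e0; rewrite near_withinE => /nbhs_normcP[r r0 Hr].
  exists r => // h h0 hr; have := Hr h.
  by rewrite subr0 /= -[h *: 1]/(h * 1) mulr1 (addrC h) => /(_ hr h0).
- move=> [d H]; apply/cvg_ex; exists d; apply/cvg_normcP => e e0.
  have [r r0 Hr] := H e e0.
  rewrite near_withinE; apply/nbhs_normcP; exists r => // h; rewrite subr0 => hr h0.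
  by have := Hr h h0 hr; rewrite /= -[h *: 1]/(h * 1) mulr1 (addrC z).
Qed.

Lemma derivable_cont (f : C -> C) (z : C) : derivable f z 1 ->
  forall e : R, 0 < e -> exists2 r : R, 0 < r &
    forall y : C, normc (y - z) < r -> normc (f y - f z) < e.
Proof.
move=> /derivable_normcP[d H] e e0.
have [r r0 Hr] := H 1 ltr01.
have M0 : 0 < normc d + 1 by rewrite ltr_wpDl ?normc_ge0.
exists (Num.min r (e / (normc d + 1))) => [|y]; first by rewrite lt_min r0 divr_gt0.
rewrite lt_min ltr_pdivlMr // => /andP[yr ye].
have [->|yz] := eqVneq y z; first by rewrite subrr normc0.
have h0 : y - z != 0 by rewrite subr_eq0.
have := Hr _ h0 yr; rewrite (addrC z) subrK => hd.
have h1 : normc ((y - z)^-1 * (f y - f z)) < normc d + 1.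
  by have := normcB_ge ((y - z)^-1 * (f y - f z)) d; lra.
have -> : f y - f z = (y - z) * ((y - z)^-1 * (f y - f z)).
  by rewrite mulrA divff // mul1r.
rewrite normcM; apply: le_lt_trans ye; apply: ler_wpM2l; first exact: normc_ge0.
exact: ltW.
Qed.

End Modulus.

(** * Elementary bounds for sine, cosine and the real exponential *)

Section RealBounds.
Variable R : realType.
Implicit Types x y : R.

Lemma sin_MVT y : 0 <= y ->
  exists2 c, c \in `[0, y]%R & sin y - sin 0 = cos c * (y - 0).
Proof.
move=> y0; apply: MVT_segment => //.
by apply: continuous_subspaceT => x; exact: continuous_sin.
Qed.

Lemma abs_sin_le y : `|sin y| <= `|y|.
Proof.
wlog y0 : y / 0 <= y.
  move=> H; have [/H//|y0] := leP 0 y.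
  by rewrite -normrN -sinN -(normrN y); apply: H; lra.
have [c _] := sin_MVT y0.
rewrite sin0 !subr0 => ->; rewrite normrM.
by rewrite ler_piMl // cos_max.
Qed.

Lemma one_sub_cos_bounds y : 0 <= 1 - cos y <= y ^+ 2 / 2.
Proof.
rewrite subr_ge0 cos_le1 /=.
have -> : cos y = 1 - 2 * sin (y / 2) ^+ 2.
  rewrite {1}(_ : y = (y / 2) *+ 2); last by rewrite mulr2n; lra.
  by rewrite cos_mulr2n sin2cos2; lra.
have := abs_sin_le (y / 2).
rewrite -(@ler_pXn2r _ 2) ?nnegrE // !real_normK ?num_real //; lra.
Qed.

Lemma abs_sin_sub_le y : `|y| <= 1 -> `|sin y - y| <= y ^+ 2.
Proof.
wlog y0 : y / 0 <= y.
  move=> H; have [/H//|y0] := leP 0 y.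
  rewrite -(normrN y) -(sqrrN y) => y1.
  have -> : `|sin y - y| = `|sin (- y) - - y|.
    by rewrite sinN -normrN; congr `|_|; lra.
  by apply: H; lra.
move=> y1.
have [c ci] := sin_MVT y0.
rewrite sin0 !subr0 => ->; move: y1 ci; rewrite ger0_norm // in_itv /= => y1 /andP[c0 cy].
have := one_sub_cos_bounds c => /andP[h1 h2].
have h3 : c ^+ 2 <= 1 by nra.
rewrite ler_norml; nra.
Qed.

(** The inequality [1 + x <= expR x] is used at [x] and at [- x]; since the two exponentials are
    inverse to each other, the second use gives an upper bound for [expR x]. *)
Lemma abs_expR_sub_le x : `|x| <= 1 / 2 -> `|expR x - 1 - x| <= 2 * x ^+ 2.
Proof.
rewrite ler_norml => /andP[x1 x2].
have h1 := expR_ge1Dx x; have h2 := expR_ge1Dx (- x).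
have h3 := expRxMexpNx_1 x; have h4 := expR_gt0 x.
by rewrite ler_norml; apply/andP; split; nra.
Qed.

End RealBounds.

(** * The complex exponential and first-order bounds for products *)

Section ComplexExp.
Variable R : realType.
Implicit Types z w : R[i].

Lemma expC0 : expC (0 : R[i]) = 1.
Proof. by rewrite /expC /= expR0 cos0 sin0 mulr1 mulr0. Qed.

Lemma expCD z w : expC (z + w) = (expC z : R[i]) * expC w.
Proof.
case: z => a b; case: w => c d; rewrite /expC /= expRD cosD sinD.
rewrite -[RHS]/(Complex _ _) /=; congr Complex; ring.
Qed.

Lemma expC_neq0 z : (expC z : R[i]) != 0.
Proof.
have : (expC z : R[i]) * expC (- z) != 0.
  by rewrite -expCD subrr expC0; exact: oner_neq0.
by rewrite mulf_eq0 negb_or => /andP[].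
Qed.

Lemma expC_bound z : normc z <= 1 / 2 ->
  normc ((expC z : R[i]) - 1 - z) <= 12 * normc z ^+ 2.
Proof.
move=> z1; have hr := normc_Re z; have hi := normc_Im z.
rewrite sqr_normcE; apply: le_trans (normc_le_ReIm _) _.
case: z z1 hr hi => x y /= z1 hr hi.
rewrite !subr0 /=.
have hx := @abs_expR_sub_le R x (le_trans hr z1).
have y1 : `|y| <= 1 by lra.
have hs := abs_sin_sub_le y1; have := one_sub_cos_bounds y => /andP[c1 c2].
move: hx hs y1 (le_trans hr z1); rewrite !ler_norml.
move=> /andP[e1 e2] /andP[s1 s2] /andP[y1 y2] /andP[x1 x2].
have E : expR x <= 2 by nra.
have E0 := expR_gt0 x.
have h1 : `|expR x * cos y - 1 - x| <= 2 * x ^+ 2 + y ^+ 2.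
  by rewrite ler_norml; apply/andP; split; nra.
have h2 : `|expR x * sin y - y| <= 10 * (x ^+ 2 + y ^+ 2).
  have -> : expR x * sin y - y = expR x * (sin y - y) + (expR x - 1) * y by ring.
  apply: le_trans (ler_normD _ _) _; rewrite !normrM (gtr0_norm E0).
  have a1 : `|sin y - y| <= y ^+ 2 by rewrite ler_norml s1 s2.
  have a2 : `|expR x - 1| <= 2 * `|x|.
    have [x0|x0] := leP 0 x.
      by rewrite (ger0_norm x0) ler_norml; apply/andP; split; nra.
    by rewrite (ltr0_norm x0) ler_norml; apply/andP; split; nra.
  have a3 : `|expR x - 1| * `|y| <= 2 * (x ^+ 2 + y ^+ 2).
    rewrite -(real_normK (num_real x)) -(real_normK (num_real y)).
    apply: le_trans (ler_wpM2r (normr_ge0 y) a2) _.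
    have := sqr_ge0 (`|x| - `|y|); have := sqr_ge0 `|x|; have := sqr_ge0 `|y|; nra.
  have := normr_ge0 (sin y - y); have := sqr_ge0 x; nra.
lra.
Qed.

(** The linear terms of [1 - z] and [expC z] cancel, so a primary factor differs from 1 only to
    second order; this is why square summability suffices. *)
Lemma primary_factor_bound z : normc z <= 1 / 2 ->
  normc ((1 - z) * (expC z : R[i]) - 1) <= 20 * normc z ^+ 2.
Proof.
move=> z1; have h := expC_bound z1.
have -> : (1 - z) * (expC z : R[i]) - 1 = (1 - z) * ((expC z : R[i]) - 1 - z) - z * z by ring.
apply: le_trans (normcB_le _ _) _; rewrite !normcM.
have h2 : normc (1 - z) <= 3 / 2.
  by have := normcB_le 1 z; rewrite normc1; lra.
have := normc_ge0 (1 - z); have := normc_ge0 z.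
have := normc_ge0 ((expC z : R[i]) - 1 - z); nra.
Qed.

(** While the deviations sum to at most 1/2, every partial product has modulus at most 2, so each
    new factor moves it by at most twice its own deviation. *)
Lemma prod_sub1_bound (x : nat -> R[i]) N : \sum_(n < N) normc (x n - 1) <= 1 / 2 ->
  normc (\prod_(n < N) x n - 1) <= 2 * \sum_(n < N) normc (x n - 1).
Proof.
elim: N => [|N IH]; first by rewrite !big_ord0 subrr normc0 mulr0.
rewrite !big_ord_recr /= => H.
have h0 := normc_ge0 (x N - 1).
have h1 : 0 <= \sum_(n < N) normc (x n - 1) by apply: sumr_ge0 => i _; exact: normc_ge0.
have /IH {}IH : \sum_(n < N) normc (x n - 1) <= 1 / 2 by lra.
set P := \prod_(n < N) x n in IH *; set S := \sum_(n < N) _ in IH H h1 *.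
have -> : P * x N - 1 = (P - 1) + P * (x N - 1) by ring.
apply: le_trans (normcD_le _ _) _; rewrite normcM.
have hP : normc P <= 2.
  by have := normcD_le (P - 1) 1; rewrite subrK normc1; lra.
nra.
Qed.

(** The primary factors contribute only second-order terms, so the linear term comes from the
    exponential alone. The constants do not depend on [N], which lets the estimate pass to the
    limit. *)
Lemma exp_prod_bound (K M : R) (beta h : R[i]) (s : nat -> R[i]) N :
  0 <= M -> normc beta <= M -> \sum_(n < N) normc (s n) ^+ 2 <= K ->
  normc h * (K + M + 1) <= 1 / 40 ->
  normc ((expC (beta * h) : R[i]) * \prod_(n < N) ((1 - s n * h) * (expC (s n * h) : R[i]))
     - (1 + beta * h)) <= (100 * K + 12 * M ^+ 2) * normc h ^+ 2.
Proof.
move=> M0 bM sK hK.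
have nh := normc_ge0 h; have nb := normc_ge0 beta.
have K0 : 0 <= K.
  by apply: le_trans sK; apply: sumr_ge0 => i _; exact: sqr_ge0.
have hN n : (n < N)%N -> normc (s n) <= K + 1.
  move=> nN; have : normc (s n) ^+ 2 <= K.
    apply: le_trans sK; rewrite (bigD1 (Ordinal nN)) //= lerDl.
    by apply: sumr_ge0 => i _; exact: sqr_ge0.
  have := normc_ge0 (s n); nra.
have bh : normc (beta * h) <= 1 / 40 by rewrite normcM; nra.
have hb := @expC_bound (beta * h) _.
have {}hb : normc ((expC (beta * h) : R[i]) - 1 - beta * h) <= 12 * M ^+ 2 * normc h ^+ 2.
  apply: le_trans (hb _) _; first lra.
  rewrite normcM exprMn mulrA; apply: ler_wpM2r; first exact: sqr_ge0.
  by rewrite ler_pM2l // ler_pXn2r ?nnegrE.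
set E := (expC (beta * h) : R[i]) in hb *.
set P := \prod_(n < N) _.
have hS : \sum_(n < N) normc ((1 - s n * h) * (expC (s n * h) : R[i]) - 1)
     <= 20 * K * normc h ^+ 2.
  apply: (@le_trans _ _ (\sum_(n < N) (20 * normc h ^+ 2) * normc (s n) ^+ 2)).
    apply: ler_sum => n _.
    have := @primary_factor_bound (s n * h); rewrite normcM exprMn => H.
    have {}H := H _; apply: le_trans (H _) _; last by lra.
    have := hN _ (ltn_ord n); have := normc_ge0 (s n); nra.
  rewrite -mulr_sumr; have := sqr_ge0 (normc h); nra.
have hP : normc (P - 1) <= 40 * K * normc h ^+ 2.
  have := @prod_sub1_bound (fun n => (1 - s n * h) * (expC (s n * h) : R[i])) N.
  rewrite -/P => H; have {}H := H _.
  apply: le_trans (H _) _; last by lra.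
  apply: le_trans hS _; nra.
have hE : normc E <= 2.
  have := normcD_le (E - 1 - beta * h) (1 + beta * h).
  have -> : E - 1 - beta * h + (1 + beta * h) = E by ring.
  have := normcD_le 1 (beta * h); rewrite normc1.
  have hM : normc h * M <= 1 / 40 by nra.
  have hM0 := mulr_ge0 nh M0.
  have : 12 * M ^+ 2 * normc h ^+ 2 = 12 * (normc h * M) ^+ 2 by ring.
  by nra.
have -> : E * P - (1 + beta * h) = E * (P - 1) + (E - 1 - beta * h) by ring.
apply: le_trans (normcD_le _ _) _; rewrite normcM.
have := normc_ge0 E; have := normc_ge0 (P - 1); have := sqr_ge0 (normc h); nra.
Qed.

End ComplexExp.

(** * Real and imaginary parts of sums *)

Lemma Re_sum (R : realType) (x : nat -> R[i]) N :
  complex.Re (\sum_(n < N) x n) = \sum_(n < N) complex.Re (x n).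
Proof.
elim: N => [|N IH]; rewrite ?big_ord0 // !big_ord_recr /= -IH.
by case: (\sum_(_ < _) _) (x N) => ? ? [].
Qed.

Lemma Im_sum (R : realType) (x : nat -> R[i]) N :
  complex.Im (\sum_(n < N) x n) = \sum_(n < N) complex.Im (x n).
Proof.
elim: N => [|N IH]; rewrite ?big_ord0 // !big_ord_recr /= -IH.
by case: (\sum_(_ < _) _) (x N) => ? ? [].
Qed.

Lemma ReD (R : realType) (x y : R[i]) : complex.Re (x + y) = complex.Re x + complex.Re y.
Proof. by case: x y => ? ? []. Qed.

Lemma ImD (R : realType) (x y : R[i]) : complex.Im (x + y) = complex.Im x + complex.Im y.
Proof. by case: x y => ? ? []. Qed.

Lemma ImB (R : realType) (x y : R[i]) : complex.Im (x - y) = complex.Im x - complex.Im y.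
Proof. by case: x y => ? ? []. Qed.

(** * Series with bounded partial sums *)

Section BoundedSums.
Variable R : realType.
Local Notation C := ((R[i])^o).

Definition bsum (a : nat -> R) : Prop := exists K, forall N, \sum_(n < N) a n <= K.

Lemma ler_sum_widen (a : nat -> R) k N : (forall n, 0 <= a n) ->
  \sum_(n < N) a n <= \sum_(n < k + N) a n.
Proof.
by move=> a0; rewrite addnC big_split_ord /= lerDl sumr_ge0.
Qed.

(** Comparison test: the first [n0] terms, on which nothing is assumed, are absorbed into the
    constant. *)
Lemma bsum_eventually_le (a a' : nat -> R) n0 K :
  (forall n, 0 <= a' n) -> 0 <= K ->
  (forall n, (n0 <= n)%N -> a n <= K * a' n) -> bsum a' -> bsum a.
Proof.
move=> a'0 K0 H [M HM]; exists (\sum_(n < n0) `|a n| + K * M) => N.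
apply: (@le_trans _ _ (\sum_(n < N) ((if (n < n0)%N then `|a n| else 0) + K * a' n))).
  apply: ler_sum => n _; case: ltnP => hn; last by rewrite add0r; exact: H.
  by rewrite -[leLHS]addr0 lerD ?ler_norm // mulr_ge0.
rewrite big_split /= -mulr_sumr; apply: lerD; last by apply: ler_wpM2l => //; exact: HM.
apply: le_trans (@ler_sum_widen (fun n => if (n < n0)%N then `|a n| else 0) n0 N _) _.
  by move=> n; case: ifP.
rewrite big_split_ord /= [X in _ + X]big1 ?addr0.
  by apply: ler_sum => i _; rewrite ltn_ord.
by move=> i _; rewrite ltnNge leq_addr.
Qed.

Lemma bsum_cvg (a : nat -> R) : (forall n, 0 <= a n) -> bsum a ->
  exists l : R, (fun N => \sum_(n < N) a n) @ \oo --> l.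
Proof.
move=> a0 [K HK].
suff : cvg ((fun N => \sum_(n < N) a n) @ \oo) by move=> /cvg_ex.
apply: nondecreasing_is_cvgn.
  apply/nondecreasing_seqP => n; rewrite big_ord_recr /= lerDl; exact: a0.
by exists K => _ [n _ <-].
Qed.

Lemma bsum_tail (a : nat -> R) (e : R) : (forall n, 0 <= a n) -> bsum a -> 0 < e ->
  exists n0, forall N, \sum_(n < N) a (n0 + n)%N <= e.
Proof.
move=> a0 ba e0; have [l Hl] := bsum_cvg a0 ba.
have ub N : \sum_(n < N) a n <= l.
  apply: (cvgr_to_ge Hl); exists N => // M /= NM.
  by rewrite -(subnK NM); exact: ler_sum_widen.
have : l - e < l by lra.
move=> /(cvgr_gt _ Hl)[n0 _ /(_ n0 (leqnn n0)) /= h].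
by exists n0 => N; have := ub (n0 + N)%N; rewrite big_split_ord /=; lra.
Qed.

Lemma abs_bsum_cvg_real (a : nat -> R) : bsum (fun n => `|a n|) ->
  exists l : R, (fun N => \sum_(n < N) a n) @ \oo --> l.
Proof.
move=> ba.
have [l1 h1] := bsum_cvg (fun n => normr_ge0 (a n)) ba.
have [||l2 h2] := @bsum_cvg (fun n => `|a n| + a n).
- by move=> n; rewrite -lerBlDr sub0r -normrN ler_norm.
- apply: (@bsum_eventually_le _ (fun n => `|a n|) 0 2) => // n _.
  by have := ler_norm (a n); lra.
exists (l2 - l1).
rewrite (_ : (fun N => _) =
    (fun N => \sum_(n < N) (`|a n| + a n) - \sum_(n < N) `|a n|)); last first.
  by apply/funext => N; rewrite big_split /= addrAC subrr add0r.
exact: cvgB h2 h1.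
Qed.

Lemma abs_bsum_cvg (x : nat -> R[i]) : bsum (fun n => normc (x n)) ->
  exists l : C, (fun N => (\sum_(n < N) x n : C)) @ \oo --> l.
Proof.
move=> bx.
have [|a ha] := @abs_bsum_cvg_real (fun n => complex.Re (x n)).
  apply: (@bsum_eventually_le _ (fun n => normc (x n)) 0 1) => // n; first exact: normc_ge0.
  by rewrite mul1r normc_Re.
have [|b hb] := @abs_bsum_cvg_real (fun n => complex.Im (x n)).
  apply: (@bsum_eventually_le _ (fun n => normc (x n)) 0 1) => // n; first exact: normc_ge0.
  by rewrite mul1r normc_Im.
exists (Complex a b); apply: cvg_complex.
- by under eq_fun do rewrite Re_sum.
- by under eq_fun do rewrite Im_sum.
Qed.

End BoundedSums.

(** * Partial products and partial sums of the logarithmic derivative *)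

Section CanonicalProduct.
Variables (R : realType) (m : nat) (r : nat -> R) (c b : R[i]).
Local Notation C := ((R[i])^o).
Implicit Types (z w h u : R[i]) (n N : nat).

(* The [m] factors [z] and the primary factors [(1 - r n z) exp (r n z)] are
   treated uniformly as [(zp n - zq n z) exp (zg n z)]. *)
Definition zp n : R := if (n < m)%N then 0 else 1.
Definition zq n : R := if (n < m)%N then -1 else r (n - m).
Definition zg n : R := if (n < m)%N then 0 else r (n - m).

Definition lin n z : R[i] := (zp n)%:C - (zq n)%:C * z.
(** With [a = zp n / zq n] the zero of the n-th factor, this is [1 / (a - z)]. It is 0 when
    [zq n = 0], that is, when the factor is constantly 1. *)
Definition sres n z : R[i] := (zq n)%:C / lin n z.
Definition regular z : Prop := forall n, lin n z != 0.

Definition cprod N z : R[i] :=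
  c * expC (b * z) * \prod_(n < N) (lin n z * expC ((zg n)%:C * z)).
(** The logarithmic derivative of [cprod N]: the n-th factor contributes [zg n] from its exponential
    and [- sres n z] from its linear part. *)
Definition logder_part N z : R[i] := b + \sum_(n < N) ((zg n)%:C - sres n z).
Definition logder z : R[i] := lim ((fun N => (logder_part N z : C)) @ \oo).

Lemma cprodE N z : cprod (m + N) z =
  c * z ^+ m * expC (b * z) * \prod_(n < N) ((1 - (r n)%:C * z) * expC ((r n)%:C * z)).
Proof.
rewrite /cprod big_split_ord /=.
rewrite [X in _ * (X * _)](eq_bigr (fun=> z)) => [|i _]; last first.
  by rewrite /lin /zp /zq /zg ltn_ord rmorphN1 rmorph0 mul0r expC0 mulr1 add0r mulN1r opprK.
rewrite prodr_const card_ord.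
rewrite [X in _ * (_ * X)](eq_bigr
    (fun i : 'I_N => (1 - (r i)%:C * z) * expC ((r i)%:C * z))) => [|i _]; last first.
  by rewrite /lin /zp /zq /zg ltnNge leq_addr /= addKn rmorph1.
ring.
Qed.

Lemma lin_shift n w h : lin n w != 0 -> lin n (w + h) = lin n w * (1 - sres n w * h).
Proof. by move=> l0; rewrite /sres /lin in l0 *; field. Qed.

(** Recentering at [w]: the n-th linear factor splits off [1 - sres n w * h], and writing [zg n] as
    [(zg n - sres n w) + sres n w] divides its exponent. The quotient is again an exponential times
    primary factors, with [sres n w] for the reciprocal zeros and [logder_part N w] for [b]. *)
Lemma cprod_shift N w h : regular w ->
  cprod N (w + h) = cprod N w * ((expC (logder_part N w * h) : R[i]) *
     \prod_(n < N) ((1 - sres n w * h) * (expC (sres n w * h) : R[i]))).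
Proof.
move=> rw; elim: N => [|N IH].
  by rewrite /cprod /logder_part !big_ord0 addr0 mulrDr expCD; ring.
have step k z : cprod k.+1 z = cprod k z * (lin k z * expC ((zg k)%:C * z)).
  by rewrite /cprod big_ord_recr /= mulrA.
have lstep : logder_part N.+1 w = logder_part N w + ((zg N)%:C - sres N w).
  by rewrite /logder_part big_ord_recr /= addrA.
rewrite !step IH lstep big_ord_recr /= (lin_shift h (rw N)).
rewrite (mulrDl (logder_part N w)) (mulrDr (zg N)%:C) !expCD.
have -> : (expC ((zg N)%:C * h) : R[i]) =
    (expC (((zg N)%:C - sres N w) * h) : R[i]) * expC (sres N w * h).
  by rewrite -expCD -mulrDl subrK.
ring.
Qed.

Lemma sres_shift n w u : lin n w != 0 -> sres n (w + u) = sres n w / (1 - sres n w * u).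
Proof.
by move=> l0; rewrite {1}/sres (lin_shift u l0) invfM mulrA.
Qed.

(** For real [a], [1 / (a - w)] is the conjugate of [a - w] over its squared modulus. If the factor
    vanishes, both sides are 0 because the inverse of 0 is 0. *)
Lemma Im_sres n w : complex.Im (sres n w) = complex.Im w * normc (sres n w) ^+ 2.
Proof.
have [l0|l0] := eqVneq (lin n w) 0.
  by rewrite /sres l0 invr0 mulr0 normc0 expr0n mulr0.
rewrite /sres normc_div exprMn exprVn (sqr_normcE (lin n w)) normc_real real_normK ?num_real //.
have : complex.Re (lin n w) ^+ 2 + complex.Im (lin n w) ^+ 2 != 0.
  by rewrite -sqr_normcE sqrf_eq0 normc_eq0.
have : complex.Im (lin n w) = - zq n * complex.Im w.
  by rewrite /lin; case: w {l0} => x y /=; ring.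
case: (lin n w) => x y /= -> D.
by rewrite mul0r addr0; field.
Qed.

Definition rsres n (x : R) : R := zq n / (zp n - zq n * x).

Lemma lin_real n (x : R) : lin n x%:C = (zp n - zq n * x)%:C.
Proof. by rewrite /lin rmorphB rmorphM. Qed.

Lemma sres_real n (x : R) : sres n x%:C = (rsres n x)%:C.
Proof. by rewrite /sres lin_real /rsres fmorph_div. Qed.

Hypothesis r2 : bsum (fun n => r n ^+ 2).

Lemma zg_bsum : bsum (fun n => zg n ^+ 2).
Proof.
have [K HK] := r2; exists K => N.
apply: le_trans (@ler_sum_widen R (fun n => zg n ^+ 2) m N _) _.
  by move=> n; exact: sqr_ge0.
rewrite big_split_ord /= big1 ?add0r => [|i _]; last first.
  by rewrite /zg ltn_ord expr0n.
apply: le_trans (HK N); apply: ler_sum => i _.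
by rewrite /zg ltnNge leq_addr /= addKn.
Qed.

Lemma sum_sqr_le (a : nat -> R) (e : R) n N : (n < N)%N -> \sum_(n < N) a n ^+ 2 <= e ->
  a n ^+ 2 <= e.
Proof.
move=> nN; apply: le_trans; rewrite (bigD1 (Ordinal nN)) //= lerDl.
by apply: sumr_ge0 => i _; exact: sqr_ge0.
Qed.

Lemma zg_small (e : R) : 0 < e -> exists2 n0, (m <= n0)%N & forall N,
  \sum_(n < N) zg (n0 + n) ^+ 2 <= e.
Proof.
move=> e0; have [n0 H] := bsum_tail (fun n => sqr_ge0 (zg n)) zg_bsum e0.
exists (m + n0)%N => [|N]; first exact: leq_addr.
apply: le_trans (H (m + N)%N); rewrite [leRHS]big_split_ord /= [leRHS]addrC.
under eq_bigr do rewrite (addnC m) -addnA.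
by rewrite lerDl; apply: sumr_ge0 => i _; exact: sqr_ge0.
Qed.

Lemma zg_tail_small (e : R) : 0 < e -> exists2 n0, (m <= n0)%N & forall n,
  (n0 <= n)%N -> `|zg n| <= e.
Proof.
move=> e0; have [n0 mn0 H] := zg_small (exprn_gt0 2 e0); exists n0 => // n n0n.
have := @sum_sqr_le (fun k => zg (n0 + k)%N) _ (n - n0) _ (ltnSn _) (H _).
by rewrite subnKC // -(real_normK (num_real (zg n))) ler_pXn2r ?nnegrE // ltW.
Qed.

Lemma lin_primary n z : (m <= n)%N -> lin n z = 1 - (zg n)%:C * z.
Proof. by move=> mn; rewrite /lin /zp /zq /zg ltnNge mn. Qed.

Lemma zq_primary n : (m <= n)%N -> zq n = zg n.
Proof. by move=> mn; rewrite /zq /zg ltnNge mn. Qed.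

Lemma small_mul (a e : R) z : 0 <= e -> `|a| <= e / (normc z + 1) -> normc (a%:C * z) <= e.
Proof.
move=> e0; have z0 := normc_ge0 z; rewrite ler_pdivlMr ?ltr_wpDl // => H.
rewrite normcM normc_real; apply: le_trans H.
by apply: ler_wpM2l; rewrite // lerDl.
Qed.

(** Once [zg n * w] has modulus at most 1/2, the denominator has modulus at least 1/2, so [sres n w]
    is at most twice [zg n] in modulus; squaring gives the factor 4. *)
Lemma sres_bsum w : bsum (fun n => normc (sres n w) ^+ 2).
Proof.
have w1 : 0 < (1 / 2 : R) / (normc w + 1) by rewrite divr_gt0 // ltr_wpDl ?normc_ge0.
have [n0 mn0 H] := zg_tail_small w1.
apply: (@bsum_eventually_le _ _ (fun n => zg n ^+ 2) n0 4) zg_bsum => //.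
  by move=> n; exact: sqr_ge0.
move=> n n0n; have mn := leq_trans mn0 n0n.
have gw : normc ((zg n)%:C * w) <= 1 / 2 by apply: small_mul => //; exact: H.
rewrite /sres normc_div (lin_primary _ mn) zq_primary // normc_real.
have l2 : 1 / 2 <= normc (1 - (zg n)%:C * w).
  by have := normcB_ge 1 ((zg n)%:C * w); rewrite normc1; lra.
rewrite exprMn real_normK ?num_real // mulrC ler_wpM2r ?sqr_ge0 //.
have l4 : 1 / 4 <= normc (1 - (zg n)%:C * w) ^+ 2 by nra.
by rewrite exprVn -[leLHS]mul1r ler_pdivrMr; move: l4; set t := normc _; lra.
Qed.

(** Past the first [m] indices [zg n - sres n w] equals [- sres n w * zg n * w], and a product of
    two square-summable sequences is absolutely summable. *)
Lemma logder_cvg w : regular w -> (fun N => (logder_part N w : C)) @ \oo --> (logder w : C).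
Proof.
move=> rw; suff [l Hl] : exists l : C, (fun N => (logder_part N w : C)) @ \oo --> l.
  by have /cvgP := Hl.
have [|l Hl] := @abs_bsum_cvg R (fun n => (zg n)%:C - sres n w).
  have bs : bsum (fun n => zg n ^+ 2 + normc (sres n w) ^+ 2).
    have [K1 H1] := zg_bsum; have [K2 H2] := sres_bsum w.
    by exists (K1 + K2) => N; rewrite big_split lerD.
  apply: (@bsum_eventually_le _ _ _ m (normc w) _ (normc_ge0 w) _ bs).
    by move=> n; rewrite addr_ge0 // sqr_ge0.
  move=> n mn; have l0 := rw n.
  have -> : (zg n)%:C - sres n w = - (sres n w * ((zg n)%:C * w)).
    move: l0; rewrite /sres (lin_primary _ mn) zq_primary // => l0.
    by field.
  rewrite normc_opp (normcM (sres n w)) (normcM (zg n)%:C) normc_real.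
  rewrite mulrA mulrC ler_wpM2l ?normc_ge0 //.
  rewrite -(real_normK (num_real (zg n))).
  set t := `|zg n|; set v := normc (sres n w).
  have := sqr_ge0 (t - v); have := sqr_ge0 t; have := sqr_ge0 v; nra.
exists ((b : C) + l).
exact: (@cvgD _ C _ _ _ (fun=> (b : C)) _ _ _ (cvg_cst _) Hl).
Qed.

(** This keeps the limit away from 0: the factors beyond some [n0] multiply to within 1/4 of 1, so
    later partial products keep at least half the modulus of the nonzero one at [n0]. *)
Lemma cprod_lower w : regular w -> c != 0 ->
  exists2 e : R, 0 < e & \forall N \near \oo, e <= normc (cprod N w).
Proof.
move=> rw c0.
set W := normc w + 1.
have W0 : 0 < W by rewrite ltr_wpDl ?normc_ge0.
(* This makes [20 * W ^+ 2 * eps] equal to 1/8 and keeps each tail term [zg n * w] at modulus at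
   most 1/2. *)
pose eps : R := (1 / (160 * W ^+ 2)).
have W1 : 1 <= W by rewrite /W lerDr normc_ge0.
have eps0 : 0 < eps by rewrite divr_gt0 // mulr_gt0 // exprn_gt0.
have [n0 mn0 H] := zg_small eps0.
have c1 : 0 < normc (cprod n0 w).
  rewrite normc_gt0 /cprod; apply: mulf_neq0; first by rewrite mulf_neq0 ?expC_neq0.
  by apply/prodf_neq0 => i _; rewrite mulf_neq0 ?expC_neq0.
exists (normc (cprod n0 w) / 2); first by rewrite divr_gt0.
exists n0 => // N /= n0N; rewrite -(subnKC n0N).
set k := (N - n0)%N.
pose x n : R[i] := lin (n0 + n) w * expC ((zg (n0 + n))%:C * w).
have -> : cprod (n0 + k) w = cprod n0 w * \prod_(n < k) x n.
  by rewrite {1}/cprod big_split_ord /= [LHS]mulrA.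
rewrite (normcM (cprod n0 w)) ler_pM2l //.
have hh n : (n < k)%N -> normc ((zg (n0 + n))%:C * w) <= 1 / 2.
  move=> nk; apply: small_mul => //; rewrite -/W.
  have := @sum_sqr_le (fun j => zg (n0 + j)%N) _ n _ nk (H k).
  rewrite /eps -(real_normK (num_real (zg (n0 + n)))) => h.
  rewrite -(@ler_pXn2r _ 2) ?nnegrE ?divr_ge0 ?(ltW W0) //.
  apply: le_trans h _.
  rewrite -[leLHS]/(1 / _) ler_pdivrMr ?mulr_gt0 ?exprn_gt0 //.
  have -> : (1 / 2 / W) ^+ 2 * (160 * W ^+ 2) = 40 by field; rewrite gt_eqF.
  lra.
have hx n : (n < k)%N -> normc (x n - 1) <= 20 * W ^+ 2 * zg (n0 + n) ^+ 2.
  move=> nk; rewrite /x lin_primary ?(leq_trans mn0) ?leq_addr //.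
  apply: le_trans (primary_factor_bound (hh _ nk)) _.
  rewrite normcM normc_real exprMn real_normK ?num_real // -mulrA ler_pM2l //.
  rewrite mulrC ler_wpM2r ?sqr_ge0 // ler_pXn2r ?nnegrE ?normc_ge0 ?(ltW W0) //.
  by rewrite /W lerDl.
have hs : \sum_(n < k) normc (x n - 1) <= 1 / 8.
  apply: (@le_trans _ _ (\sum_(n < k) 20 * W ^+ 2 * zg (n0 + n) ^+ 2)).
    by apply: ler_sum => i _; exact: hx.
  rewrite -mulr_sumr.
  have W20 : 0 <= 20 * W ^+ 2 by rewrite mulr_ge0 // sqr_ge0.
  apply: le_trans (ler_wpM2l W20 (H k)) _.
  by rewrite /eps le_eqVlt; apply/orP; left; apply/eqP; field; rewrite gt_eqF.
have := @prod_sub1_bound R x k; move=> P.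
have {}P : normc (\prod_(n < k) x n - 1) <= 1 / 4.
  by apply: le_trans (P _) _; lra.
have := normcD_ge 1 (\prod_(n < k) x n - 1).
rewrite (addrC 1) subrK normc1; lra.
Qed.

End CanonicalProduct.

(** * Arithmetic of complex limits *)

Section ComplexLimits.
Variable R : realType.
Local Notation C := ((R[i])^o).
Implicit Types (u v : nat -> R[i]) (x y : R[i]).

Lemma cvgcD u v x y : (u : nat -> C) @ \oo --> (x : C) -> (v : nat -> C) @ \oo --> (y : C) ->
  ((fun n => u n + v n) : nat -> C) @ \oo --> (x + y : C).
Proof. exact: cvgD. Qed.

Lemma cvgcB u v x y : (u : nat -> C) @ \oo --> (x : C) -> (v : nat -> C) @ \oo --> (y : C) ->
  ((fun n => u n - v n) : nat -> C) @ \oo --> (x - y : C).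
Proof. exact: cvgB. Qed.

Lemma cvgcM u v x y : (u : nat -> C) @ \oo --> (x : C) -> (v : nat -> C) @ \oo --> (y : C) ->
  ((fun n => u n * v n) : nat -> C) @ \oo --> (x * y : C).
Proof. exact: (@cvgM C). Qed.

End ComplexLimits.

(** * Local expansion of [f] and of its logarithmic derivative *)

Section ProductLimit.
Variables (R : realType) (m : nat) (r : nat -> R) (c b : R[i]).
Local Notation C := ((R[i])^o).
Implicit Types (z w h u : R[i]) (n N : nat).

Local Notation lin := (lin m r).
Local Notation sres := (sres m r).
Local Notation regular := (regular m r).
Local Notation cprod := (cprod m r c b).
Local Notation logder_part := (logder_part m r b).
Local Notation logder := (logder m r b).

Hypothesis r2 : bsum (fun n => r n ^+ 2).
Hypothesis c0 : c != 0.
Variable f : C -> C.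
Hypothesis flim : forall z : R[i], (fun N => (cprod N z : C)) @ \oo --> (f z : C).

Lemma neq0_regular w : f w != 0 -> regular w.
Proof.
move=> fw n; apply: contraNneq fw => l0.
rewrite -normc_eq0; apply/eqP/le_anti; rewrite normc_ge0 andbT.
apply: (cvgr_to_le (cvg_normc (@flim w))); exists n.+1 => // N /= nN.
by rewrite /cprod (bigD1 (Ordinal nN)) //= l0 !(mul0r, mulr0) normc0.
Qed.

Lemma regular_neq0 w : regular w -> f w != 0.
Proof.
move=> rw; have [e e0 He] := cprod_lower b r2 rw c0.
rewrite -normc_gt0; apply: lt_le_trans e0 _.
exact: (cvgr_to_ge (cvg_normc (@flim w))).
Qed.

Lemma sres_le w K n : (forall N, \sum_(n < N) normc (sres n w) ^+ 2 <= K) ->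
  normc (sres n w) <= K + 1.
Proof.
move=> /(_ n.+1) H.
have := @sum_sqr_le R (fun k => normc (sres k w)) K n n.+1 (ltnSn n) H.
have := normc_ge0 (sres n w); set t := normc _; nra.
Qed.

Section Nearby.
Variables (w u : R[i]) (K : R).
Hypothesis rw : regular w.
Hypothesis sK : forall N, \sum_(n < N) normc (sres n w) ^+ 2 <= K.
Hypothesis uK : normc u * (K + 1) <= 1 / 2.

Lemma sres_mul_small n : normc (sres n w * u) <= 1 / 2.
Proof.
rewrite (normcM (sres n w)); apply: le_trans uK; rewrite mulrC.
by apply: ler_wpM2l; [exact: normc_ge0|exact: sres_le].
Qed.

Lemma one_sub_sres_ge n : 1 / 2 <= normc (1 - sres n w * u).
Proof.
have := normcB_ge 1 (sres n w * u); rewrite normc1.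
by have := sres_mul_small n; set t := normc (sres n w * u); lra.
Qed.

Lemma one_sub_sres_neq0 n : 1 - sres n w * u != 0.
Proof. by rewrite -normc_gt0; apply: lt_le_trans (one_sub_sres_ge n); lra. Qed.

Lemma one_sub_sres_inv_le n : normc (1 - sres n w * u)^-1 <= 2.
Proof.
rewrite normcV; have := one_sub_sres_ge n; set t := normc _ => t2.
by rewrite -[leLHS]mul1r ler_pdivrMr; lra.
Qed.

Lemma regular_near : regular (w + u).
Proof. by move=> n; rewrite lin_shift // mulf_neq0 ?rw // one_sub_sres_neq0. Qed.

Lemma sres_near_le n : normc (sres n (w + u)) <= 2 * normc (sres n w).
Proof.
rewrite sres_shift // (normcM (sres n w)) mulrC.
by apply: ler_wpM2r; [exact: normc_ge0|exact: one_sub_sres_inv_le].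
Qed.

Lemma sres_near_bound N : \sum_(n < N) normc (sres n (w + u)) ^+ 2 <= 4 * K.
Proof.
apply: le_trans (ler_wpM2l _ (sK N)) => //; rewrite mulr_sumr.
apply: ler_sum => n _; have := sres_near_le n; have := normc_ge0 (sres n (w + u)).
set s := normc (sres n w); set t := normc _; nra.
Qed.

Lemma logder_part_sub N : logder_part N (w + u) - logder_part N w =
  - \sum_(n < N) (sres n w ^+ 2 * u / (1 - sres n w * u)).
Proof.
rewrite /logder_part opprD addrACA subrr add0r -sumrB -sumrN; apply: eq_bigr => n _.
have l0 := one_sub_sres_neq0 n.
by rewrite (@sres_shift R m r n w u (rw n)); field.
Qed.

Lemma logder_part_near1 N :
  normc (logder_part N (w + u) - logder_part N w) <= 2 * K * normc u.
Proof.
rewrite logder_part_sub normc_opp.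
apply: le_trans (normc_sum_le (fun n => sres n w ^+ 2 * u / (1 - sres n w * u)) N) _.
apply: (@le_trans _ _ (\sum_(n < N) (2 * normc u) * normc (sres n w) ^+ 2)).
  apply: ler_sum => n _.
  rewrite (normcM (sres n w ^+ 2 * u)) (normcM (sres n w ^+ 2)) normcX.
  have t0 := mulr_ge0 (sqr_ge0 (normc (sres n w))) (normc_ge0 u).
  apply: le_trans (ler_wpM2l t0 (one_sub_sres_inv_le n)) _.
  by rewrite le_eqVlt; apply/orP; left; apply/eqP; ring.
rewrite -mulr_sumr [2 * K * _]mulrAC; apply: ler_wpM2l (sK N).
by rewrite mulr_ge0 ?normc_ge0.
Qed.

(** Replacing each denominator [1 - sres n w * u] by 1 costs a further factor of order
    [sres n w * u]; so the derivative of [logder_part N] at [w] is minus the sum of the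
    [sres n w ^+ 2]. *)
Lemma logder_part_near2 N :
  normc (logder_part N (w + u) - logder_part N w + (\sum_(n < N) sres n w ^+ 2) * u)
    <= 2 * K * (K + 1) * normc u ^+ 2.
Proof.
rewrite logder_part_sub addrC mulr_suml -sumrB.
apply: le_trans (normc_sum_le
  (fun n => sres n w ^+ 2 * u - sres n w ^+ 2 * u / (1 - sres n w * u)) N) _.
apply: (@le_trans _ _ (\sum_(n < N) (2 * (K + 1) * normc u ^+ 2) * normc (sres n w) ^+ 2)).
  apply: ler_sum => n _.
  have l0 := one_sub_sres_neq0 n.
  have -> : sres n w ^+ 2 * u - sres n w ^+ 2 * u / (1 - sres n w * u) =
      - ((sres n w * u) ^+ 2 * (sres n w * (1 - sres n w * u)^-1)).
    by field.
  rewrite normc_opp (normcM ((sres n w * u) ^+ 2)) (normcM (sres n w) _^-1) normcX.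
  rewrite (normcM (sres n w) u).
  have := one_sub_sres_inv_le n; have := normc_ge0 (1 - sres n w * u)^-1.
  have := sres_le n sK; have := normc_ge0 (sres n w); have := normc_ge0 u.
  set x := normc (_^-1); set s := normc (sres n w); set t := normc u => t0 s0 sK1 x0 x2.
  have h1 : s * x <= (K + 1) * 2 by apply: ler_pM.
  have h2 := ler_wpM2l (sqr_ge0 (s * t)) h1.
  by apply: le_trans h2 _; rewrite le_eqVlt; apply/orP; left; apply/eqP; ring.
rewrite -mulr_sumr.
have a0 : 0 <= 2 * (K + 1) * normc u ^+ 2.
  have := le_trans (normc_ge0 _) (sres_le 0 sK) => K1.
  by rewrite mulr_ge0 ?sqr_ge0 // mulr_ge0.
apply: le_trans (ler_wpM2l a0 (sK N)) _.
by rewrite le_eqVlt; apply/orP; left; apply/eqP; ring.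
Qed.

Lemma logder_near1 : normc (logder (w + u) - logder w) <= 2 * K * normc u.
Proof.
have H := cvgcB (@logder_cvg R m r b r2 _ regular_near) (@logder_cvg R m r b r2 _ rw).
by apply: (cvgr_to_le (cvg_normc H)); apply: nearW => N; exact: logder_part_near1.
Qed.

Lemma logder_near2 (S2 : R[i]) :
  (fun N => (\sum_(n < N) sres n w ^+ 2 : C)) @ \oo --> (S2 : C) ->
  normc (logder (w + u) - logder w + S2 * u) <= 2 * K * (K + 1) * normc u ^+ 2.
Proof.
move=> HS.
have H := cvgcB (@logder_cvg R m r b r2 _ regular_near) (@logder_cvg R m r b r2 _ rw).
have HU : ((fun N => (\sum_(n < N) sres n w ^+ 2) * u) : nat -> C) @ \oo --> (S2 * u : C).
  by apply: cvgcM HS _; exact: cvg_cst.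
have H2 := cvgcD H HU.
by apply: (cvgr_to_le (cvg_normc H2)); apply: nearW => N; exact: logder_part_near2.
Qed.

End Nearby.

Lemma cprod_expansion w h (K M : R) N : regular w -> 0 <= M ->
  normc (logder_part N w) <= M -> \sum_(n < N) normc (sres n w) ^+ 2 <= K ->
  normc h * (K + M + 1) <= 1 / 40 ->
  normc (cprod N (w + h) - cprod N w * (1 + logder_part N w * h)) <=
    (100 * K + 12 * M ^+ 2) * normc h ^+ 2 * normc (cprod N w).
Proof.
move=> rw M0 LM sK hK; rewrite (cprod_shift c b N h rw) -mulrBr (normcM (cprod N w)) mulrC.
apply: ler_wpM2r; first exact: normc_ge0.
exact: (@exp_prod_bound R K M _ h (fun n => sres n w)).
Qed.

(** One radius and one constant serve all base points [w + u], which allows [f] to be compared at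
    two arbitrary points near [w]. The bounds are proved for partial products and sums and pass to
    the limit. *)
Lemma expansion w : regular w -> exists (d K : R), [/\ 0 < d, 0 <= K &
  forall u, normc u <= d -> [/\ regular (w + u),
    normc (logder (w + u) - logder w) <= K * normc u,
    (forall S2 : R[i], (fun N => (\sum_(n < N) sres n w ^+ 2 : C)) @ \oo --> (S2 : C) ->
      normc (logder (w + u) - logder w + S2 * u) <= K * normc u ^+ 2) &
    forall h, normc h <= d ->
      normc (f (w + u + h) - f (w + u) * (1 + logder (w + u) * h)) <=
        K * normc h ^+ 2 * normc (f (w + u))]].
Proof.
move=> rw; have [K1 HK1] := sres_bsum m r2 w.
have K10 : 0 <= K1 by have := HK1 0%N; rewrite big_ord0.
(* Of the margin 3, one unit covers passing from the limit to late partial sums and one the move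
   from [w] to [w + u]. *)
pose M := normc (logder w) + 3.
have nl := normc_ge0 (logder w).
have M0 : 0 <= M by rewrite /M; lra.
pose T := K1 + M + 1.
have T0 : 0 < 200 * T by rewrite /T; lra.
pose K := 2 * K1 + 2 * K1 * (K1 + 1) + (400 * K1 + 12 * M ^+ 2).
(* The square sums at [w + u] are bounded by [4 * K1]; this radius gives
   [normc h * (4 * K1 + M + 1) <= 1 / 50], within the range of [cprod_expansion]. *)
exists (1 / (200 * T)), K; split.
- by rewrite divr_gt0 ?ltr01.
- by rewrite /K; have := sqr_ge0 M; have := mulr_ge0 K10 K10; nra.
move=> u; rewrite (ler_pdivlMr _ _ T0) => uT; have nu := normc_ge0 u.
have uK : normc u * (K1 + 1) <= 1 / 2 by rewrite /T in uT; nra.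
have ru := regular_near rw HK1 uK.
split=> //.
- apply: le_trans (logder_near1 rw HK1 uK) _; apply: ler_wpM2r => //.
  by rewrite /K; have := sqr_ge0 M; have := mulr_ge0 K10 K10; nra.
- move=> S2 HS; apply: le_trans (logder_near2 rw HK1 uK HS) _.
  apply: ler_wpM2r; first exact: sqr_ge0.
  by rewrite /K; have := sqr_ge0 M; nra.
move=> h; rewrite (ler_pdivlMr _ _ T0) => hT; have nh := normc_ge0 h.
apply: (@le_trans _ _ ((400 * K1 + 12 * M ^+ 2) * normc h ^+ 2 * normc (f (w + u)))); last first.
  apply: ler_wpM2r; first exact: normc_ge0.
  apply: ler_wpM2r; first exact: sqr_ge0.
  by rewrite /K; have := mulr_ge0 K10 K10; nra.
have L := @logder_cvg R m r b r2 _ ru.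
have A : (fun N => (cprod N (w + u + h) - cprod N (w + u) * (1 + logder_part N (w + u) * h) : C))
    @ \oo --> (f (w + u + h) - f (w + u) * (1 + logder (w + u) * h) : C).
  apply: cvgcB; first exact: flim.
  apply: cvgcM; first exact: flim.
  apply: cvgcD; first exact: cvg_cst.
  by apply: cvgcM L _; exact: cvg_cst.
apply: (ler_cvg_to (cvg_normc A)).
  by apply: cvgM; [exact: cvg_cst|exact: cvg_normc (@flim _)].
have : normc (logder w) < normc (logder w) + 1 by lra.
move=> /(cvgr_lt _ (cvg_normc (@logder_cvg R m r b r2 _ rw))); apply: filterS => N /= LN.
have -> : 400 * K1 = 100 * (4 * K1) by ring.
apply: cprod_expansion => //.
- have := logder_part_near1 rw HK1 uK N.
  have := normcD_le (logder_part N (w + u) - logder_part N w) (logder_part N w).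
  rewrite subrK.
  have : 2 * K1 * normc u <= 1 by rewrite /T in uT; nra.
  by rewrite /M; lra.
- exact: sres_near_bound.
- by rewrite /T in hT; nra.
Qed.

End ProductLimit.

(** * Consequences of real zeros: local injectivity, monotonicity, regular intervals *)

Lemma affine_same_sign (R : realFieldType) (p q x y : R) : x <= y ->
  (forall t, x <= t <= y -> p - q * t != 0) -> 0 < (p - q * x) * (p - q * y).
Proof.
move=> xy H; rewrite ltNge; apply/negP => P.
have q0 : q != 0.
  apply/eqP => q0; have := H x; rewrite lexx xy q0 => /(_ isT).
  move: P; rewrite q0 !mul0r subr0 => P /eqP; apply; nra.
have tq : p - q * (p / q) = 0 by field.
have := H (p / q); rewrite tq eqxx => /(_ _)/negP; apply => //.
have -> : p = q * (p / q) by field.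
move: P; have -> : (p - q * x) * (p - q * y) = q ^+ 2 * ((p / q - x) * (p / q - y)) by field.
have q2 : 0 < q ^+ 2 by rewrite exprn_even_gt0.
rewrite pmulr_rle0 // mulrAC divff // mul1r.
set t := p / q => P; apply/andP; split; nra.
Qed.

Section RealProduct.
Variables (R : realType) (m : nat) (r : nat -> R) (c b : R[i]).
Local Notation C := ((R[i])^o).
Implicit Types (z w h u : R[i]) (n N : nat).

Local Notation zp := (zp R m).
Local Notation zq := (zq m r).
Local Notation zg := (zg m r).
Local Notation lin := (lin m r).
Local Notation sres := (sres m r).
Local Notation rsres := (rsres m r).
Local Notation regular := (regular m r).
Local Notation cprod := (cprod m r c b).
Local Notation logder_part := (logder_part m r b).
Local Notation logder := (logder m r b).

Hypothesis r2 : bsum (fun n => r n ^+ 2).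
Hypothesis c0 : c != 0.
Variable f : C -> C.
Hypothesis flim : forall z : R[i], (fun N => (cprod N z : C)) @ \oo --> (f z : C).

(** If [f x = f y] with [x != y], the expansion at [x] with increment [y - x] gives
    [normc (logder x) <= K * normc (y - x)]; near [w] the left side stays above half of
    [normc (logder w)] while the right side is small. *)
Lemma local_injective w : regular w -> logder w != 0 ->
  exists2 d : R, 0 < d & forall x y : R[i],
    normc (x - w) < d -> normc (y - w) < d -> f x = f y -> x = y.
Proof.
move=> rw Lw; have [d [K [d0 K0 H]]] := expansion r2 flim rw.
have L0 : 0 < normc (logder w) by rewrite normc_gt0.
set L := normc (logder w) in L0.
have K1 : 0 < 8 * (K + 1) by lra.
pose e := Num.min (d / 2) (L / (8 * (K + 1))).
have e0 : 0 < e by rewrite lt_min !divr_gt0.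
have ed : e <= d / 2 by rewrite ge_min lexx.
have eL : e * (8 * (K + 1)) <= L.
  by rewrite -ler_pdivlMr // ge_min lexx orbT.
exists e => // x y xw yw fxy.
have [|ru lu _ hu] := H (x - w); first lra.
rewrite (addrC w) subrK in ru lu hu.
have xy : normc (y - x) < 2 * e.
  by have := normc_dist_trans w y x; rewrite (normcB_sym w x); lra.
have yd : normc (y - x) <= d by lra.
have := hu _ yd; rewrite (addrC x) subrK fxy.
have fx0 : 0 < normc (f y) by rewrite -fxy normc_gt0; exact: (regular_neq0 r2 c0 flim).
have -> : f y - f y * (1 + logder x * (y - x)) = - ((f y : R[i]) * (logder x * (y - x))).
  by rewrite mulrDr mulr1 opprD addrA subrr add0r.
rewrite normc_opp (normcM (f y : R[i])) (normcM (logder x)) mulrC ler_pM2r // => h1.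
have lx : L / 2 <= normc (logder x).
  have := normcD_ge (logder w) (logder x - logder w); rewrite (addrC (logder w)) subrK -/L.
  nra.
have [//|ne] := eqVneq (y - x) 0; first by move=> /eqP; rewrite subr_eq0 => /eqP.
have t0 : 0 < normc (y - x) by rewrite normc_gt0.
exfalso; set t := normc (y - x) in t0 xy h1.
have : normc (logder x) <= K * t by rewrite -(ler_pM2r t0); lra.
have : K * t <= K * (2 * e) by rewrite ler_wpM2l // ltW.
nra.
Qed.

Lemma logder_part_real N (x : R) :
  logder_part N x%:C = b + (\sum_(n < N) (zg n - rsres n x))%:C.
Proof.
rewrite /logder_part rmorph_sum /=; congr (_ + _); apply: eq_bigr => n _.
by rewrite sres_real rmorphB.
Qed.

Lemma Im_logder_real (x : R) : regular x%:C -> complex.Im (logder x%:C) = complex.Im b.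
Proof.
move=> rx; apply: (@cvg_unique _ (@Rhausdorff R) _ _ _ _ (cvg_Im (@logder_cvg R m r b r2 _ rx))).
rewrite (_ : (fun N => _) = fun=> complex.Im b); first exact: cvg_cst.
by apply/funext => N; rewrite logder_part_real ImD addr0.
Qed.

(** As [f] is real on the real line, the imaginary part of the error in the expansion is
    [- f x * Im (logder x) * h], which must be of order [h ^+ 2]; small [h] forces it to vanish. *)
Lemma Im_logder_eq0 (x : R) : (forall t : R, complex.Im (f t%:C) = 0) ->
  regular x%:C -> complex.Im (logder x%:C) = 0.
Proof.
move=> fR rx; have [d [K [d0 K0 H]]] := expansion r2 flim rx.
have [|_ _ _] := H 0; first by rewrite normc0 ltW.
rewrite addr0 => {}H.
have fx0 : f x%:C != 0 := regular_neq0 r2 c0 flim rx.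
move: (logder x%:C) H => [l l'] /= H.
apply/eqP/negPn/negP => I0.
have I1 : 0 < `|l'| by rewrite normr_gt0.
have K1 : 0 < K + 1 by lra.
pose h := Num.min d (`|l'| / (K + 1) / 2).
have h0 : 0 < h by rewrite lt_min d0 !divr_gt0.
have hK : h * (K + 1) <= `|l'| / 2.
  by rewrite -ler_pdivlMr // mulrAC ge_min lexx orbT.
have hd : normc h%:C <= d by rewrite normc_real gtr0_norm // ge_min lexx.
have := le_trans (normc_Im _) (H _ hd); rewrite normc_real (gtr0_norm h0) -rmorphD.
have := fR (x + h); have := fR x; rewrite -normc_gt0 in fx0.
case: (f x%:C) fx0 => a a' + /= a'0; case: (f (x + h)%:C) => e e' + /= e'0.
rewrite a'0 e'0 /= expr0n addr0 sqrtr_sqr => a1 E.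
have {}E : `|a| * `|l'| * h <= K * h ^+ 2 * `|a|.
  apply: le_trans E; rewrite -{1}(gtr0_norm h0) -!normrM -normrN le_eqVlt; apply/orP; left.
  by apply/eqP; congr `|_|; ring.
have {}E : `|l'| <= K * h.
  rewrite -(ler_pM2r (mulr_gt0 a1 h0)); lra.
nra.
Qed.

(** The product of the imaginary parts of [w] and [logder w] is minus the square of the former times
    the sum of the [normc (sres n w) ^+ 2]; the k-th term alone keeps it negative. *)
Lemma logder_nonreal w k : complex.Im b = 0 -> zq k != 0 -> regular w ->
  complex.Im w != 0 -> logder w != 0.
Proof.
move=> b0 qk rw w0.
have sk : 0 < normc (sres k w) ^+ 2.
  by rewrite exprn_gt0 // normc_gt0 mulf_neq0 ?invr_neq0 // fmorph_eq0.
have w2 : 0 < complex.Im w ^+ 2 by rewrite exprn_even_gt0.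
suff : complex.Im w * complex.Im (logder w) <= - (complex.Im w ^+ 2 * normc (sres k w) ^+ 2).
  move=> H; apply/eqP => L0; move: H; rewrite L0 mulr0; have := mulr_gt0 w2 sk; lra.
have H : (fun N => complex.Im w * complex.Im (logder_part N w)) @ \oo -->
    complex.Im w * complex.Im (logder w).
  by apply: cvgM; [exact: cvg_cst|exact: cvg_Im (@logder_cvg R m r b r2 _ rw)].
apply: (cvgr_to_le H).
exists k.+1 => // N /= kN.
rewrite /logder_part ImD b0 add0r (Im_sum (fun n => (zg n)%:C - sres n w)).
rewrite (eq_bigr (fun n : 'I_N => - (complex.Im w * normc (sres n w) ^+ 2))); last first.
  by move=> i _; rewrite ImB Im_sres /= sub0r.
rewrite sumrN -mulr_sumr mulrN mulrA lerN2 -expr2 ler_pM2l //.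
rewrite (bigD1 (Ordinal kN)) //= lerDl.
by apply: sumr_ge0 => i _; exact: sqr_ge0.
Qed.

(** The n-th terms differ by [y - x] times [zq n ^+ 2] over the product of the factor's values at
    [x] and [y], which is positive because no factor changes sign on the interval. The k-th term
    gives a gap that survives the limit. *)
Lemma logder_decr (x y : R) k : x < y -> zq k != 0 ->
  (forall t, x <= t <= y -> regular t%:C) ->
  complex.Re (logder y%:C) < complex.Re (logder x%:C).
Proof.
move=> xy qk rt.
have nz n t : x <= t <= y -> zp n - zq n * t != 0.
  by move=> /rt/(_ n); rewrite lin_real fmorph_eq0.
have sg n := affine_same_sign (ltW xy) (@nz n).
have rx : regular x%:C by apply: rt; rewrite lexx ltW.
have ry : regular y%:C by apply: rt; rewrite lexx ltW.
have nx n : zp n - zq n * x != 0 by apply: nz; rewrite lexx ltW.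
have ny n : zp n - zq n * y != 0 by apply: nz; rewrite lexx ltW.
have E n : rsres n y - rsres n x = (y - x) * (zq n ^+ 2 / ((zp n - zq n * x) * (zp n - zq n * y))).
  by rewrite /rsres; have := nx n; have := ny n => *; field; apply/andP.
have E0 n : 0 <= rsres n y - rsres n x.
  rewrite E; apply: mulr_ge0; first lra.
  by apply: divr_ge0; [exact: sqr_ge0|exact: ltW].
have Ek : 0 < rsres k y - rsres k x.
  rewrite E; apply: mulr_gt0; first lra.
  by apply: divr_gt0; [rewrite exprn_even_gt0|exact: sg].
rewrite -subr_gt0; apply: lt_le_trans Ek _.
have H : (fun N => complex.Re (logder_part N x%:C) - complex.Re (logder_part N y%:C)) @ \oo -->
    complex.Re (logder x%:C) - complex.Re (logder y%:C).
  by apply: cvgB; exact: cvg_Re (@logder_cvg R m r b r2 _ _).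
apply: (cvgr_to_ge H); exists k.+1 => // N /= kN.
rewrite !logder_part_real !ReD /= opprD addrACA subrr add0r.
rewrite -sumrB (eq_bigr (fun n : 'I_N => rsres n y - rsres n x)); last first.
  by move=> i _; ring.
rewrite (bigD1 (Ordinal kN)) //= lerDl.
by apply: sumr_ge0 => i _; exact: E0.
Qed.

(** Each new factor has at most one root, so one of two disjoint closed pieces of the current
    interval avoids it. *)
Lemma regular_interval_prefix (x y : R) N : x < y ->
  exists x' y' : R, [/\ x < x', x' < y', y' < y &
    forall n t, (n < N)%N -> x' <= t <= y' -> lin n t%:C != 0].
Proof.
move=> xy; elim: N => [|N [x1 [y1 [h1 h2 h3 H]]]].
  by exists (x + (y - x) / 3), (x + 2 * (y - x) / 3); split => //; lra.
pose e := (y1 - x1) / 5.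
have e0 : 0 < e by rewrite /e; lra.
have ye : y1 = x1 + 5 * e by rewrite /e; lra.
(* If the second fifth contains the root, the fourth fifth is taken. *)
have [[t [te t0]]|nt] := pselect (exists t, x1 + e <= t <= x1 + 2 * e /\ lin N t%:C = 0).
- exists (x1 + 3 * e), (x1 + 4 * e); split; [lra|lra|lra|].
  move=> n v; rewrite ltnS leq_eqVlt => /orP[/eqP->|nN] ve; last by apply: H => //; lra.
  apply/eqP; rewrite lin_real => /eqP; rewrite fmorph_eq0 => /eqP v0.
  move: t0; rewrite lin_real => /eqP; rewrite fmorph_eq0 => /eqP t0.
  (* Two different roots would give [zq N = 0], but then [zp N = 1] and there is no root. *)
  have q0 : zq N = 0.
    have : zq N * (v - t) = 0 by lra.
    by move=> /eqP; rewrite mulf_eq0 => /orP[/eqP//|]; lra.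
  move: v0 q0; rewrite /zp /zq; case: ifP => _; last by move=> v0 q0; rewrite q0 in v0; lra.
  by move=> _; lra.
- exists (x1 + e), (x1 + 2 * e); split; [lra|lra|lra|].
  move=> n v; rewrite ltnS leq_eqVlt => /orP[/eqP->|nN] ve; last by apply: H => //; lra.
  by apply/eqP => v0; apply: nt; exists v.
Qed.

(** Only finitely many factors have to be avoided: for the later ones [zg n * t] has modulus at most
    1/2 on the whole interval, so [1 - zg n * t] cannot vanish. *)
Lemma regular_interval (x y : R) : x < y ->
  exists x' y' : R, [/\ x < x', x' < y', y' < y & forall t, x' <= t <= y' -> regular t%:C].
Proof.
move=> xy; pose M := `|x| + `|y| + 1.
have M0 : 0 < M by rewrite /M; have := normr_ge0 x; have := normr_ge0 y; lra.
have [|n0 mn0 Hn] := @zg_tail_small R m r r2 (1 / (2 * M)).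
  by rewrite divr_gt0 // mulr_gt0.
have [x1 [y1 [h1 h2 h3 H]]] := regular_interval_prefix n0 xy.
exists x1, y1; split=> // t tt n.
have [nn|nn] := ltnP n n0; first exact: H.
rewrite lin_primary ?(leq_trans mn0) // -rmorphM -(rmorph1 (real_complex R)) -rmorphB fmorph_eq0.
have := Hn n nn; rewrite ler_pdivlMr ?mulr_gt0 // => h.
have tM : `|t| <= M.
  have := ler_norm x; have := ler_norm y; have := ler_norm (- x); have := ler_norm (- y).
  by rewrite !normrN ler_norml /M; lra.
have : `|zg n * t| <= 1 / 2.
  by rewrite normrM; have := normr_ge0 (zg n); have := normr_ge0 t; nra.
rewrite ler_norml => ?; apply/eqP; lra.
Qed.

(** A positive [m] would make [zq 0 = -1], so [m = 0]; then all [r n] vanish and every factor is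
    1. *)
Lemma no_zeros : (forall k, zq k = 0) ->
  (forall z, f z = c * (expC (b * z) : R[i])) /\ (forall w, logder w = b).
Proof.
move=> q0.
have m0 : m = 0%N.
  have := q0 0%N; rewrite /zq; case: ltnP => [_ /eqP|]; first by rewrite oppr_eq0 oner_eq0.
  by rewrite leqn0 => /eqP.
have g0 n : zg n = 0 by have := q0 n; rewrite /zq /zg m0.
have l1 n z : lin n z = 1 by rewrite /lin q0 /zp m0 mul0r subr0.
split=> [z|w].
- apply: (@cvg_unique C (@norm_hausdorff _ _) _ _ _ _ (@flim z)).
  rewrite (_ : (fun N => _) = fun=> (c * (expC (b * z) : R[i]) : C)); first exact: cvg_cst.
  apply/funext => N; rewrite /cprod big1 ?mulr1 // => i _.
  by rewrite l1 g0 mul0r expC0 mulr1.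
- have rw : regular w by move=> n; rewrite l1 oner_neq0.
  apply: (@cvg_unique C (@norm_hausdorff _ _) _ _ _ _ (@logder_cvg R m r b r2 _ rw)).
  rewrite (_ : (fun N => _) = fun=> (b : C)); first exact: cvg_cst.
  apply/funext => N; rewrite /logder_part big1 ?addr0 // => i _.
  by rewrite g0 /sres q0 mul0r subr0.
Qed.

End RealProduct.

(** * Segments in the complex plane *)

Section Segments.
Variable R : realType.
Implicit Types (a b z : R[i]) (s t : R).

Definition seg a b t : R[i] := a + t%:C * (b - a).

Lemma seg0 a b : seg a b 0 = a. Proof. by rewrite /seg rmorph0 mul0r addr0. Qed.

Lemma seg1 a b : seg a b 1 = b.
Proof. by rewrite /seg rmorph1 mul1r addrC subrK. Qed.

Lemma Im_seg a b t : complex.Im (seg a b t) =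
  (1 - t) * complex.Im a + t * complex.Im b.
Proof. by case: a b => ? ? [? ?]; rewrite /seg /=; ring. Qed.

Lemma seg_dist a b s t : normc (seg a b s - seg a b t) = `|s - t| * normc (b - a).
Proof. by rewrite -normc_real -normcM rmorphB /seg; congr normc; ring. Qed.

Lemma seg_ball a b z (e : R) t : normc (a - z) < e -> normc (b - z) < e ->
  0 <= t <= 1 -> normc (seg a b t - z) < e.
Proof.
move=> az bz /andP[t0 t1].
have -> : seg a b t - z = (1 - t)%:C * (a - z) + t%:C * (b - z).
  by rewrite /seg rmorphB rmorph1; ring.
apply: le_lt_trans (normcD_le _ _) _.
rewrite !normcM !normc_real !ger0_norm ?subr_ge0 //.
have [->|tn] := eqVneq t 1; first lra.
have t2 : 0 < 1 - t by rewrite subr_gt0 lt_def t1 eq_sym tn.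
have h1 : (1 - t) * normc (a - z) < (1 - t) * e by rewrite ltr_pM2l.
have h2 : t * normc (b - z) <= t * e by rewrite ler_wpM2l // ltW.
lra.
Qed.

(** The points of the unit interval where [P] holds form a nonempty, relatively open and closed
    subset of a connected set. *)
Lemma seg_induction (P : R -> Prop) : P 0 ->
  (forall t, P t -> exists2 e, 0 < e & forall s, `|s - t| < e -> P s) ->
  (forall t, 0 <= t <= 1 -> (forall e, 0 < e -> exists2 s, `|s - t| < e & P s) -> P t) ->
  P 1.
Proof.
move=> P0 Popen Pclosed.
have := @segment_connected R 0 1 ([set` `[0, 1]%R] `&` [set t | P t]).
move=> /(_ _ _ _) H.
have i0 : [set` `[0, 1]%R] (0 : R) by rewrite /= in_itv /= lexx ler01.
have i1 : [set` `[0, 1]%R] (1 : R) by rewrite /= in_itv /= lexx ler01.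
suff E : [set` `[0, 1]%R] `&` [set t | P t] = [set` `[0, 1]%R].
  by have := i1; rewrite -E => -[].
apply: H.
- by exists 0.
- exists [set t | P t] => //; rewrite openE => t /Popen[e e0 He].
  by apply/nbhs_ballP; exists e => // s; rewrite /ball /= distrC; exact: He.
- exists (closure ([set` `[0, 1]%R] `&` [set t | P t])); first exact: closed_closure.
  apply/seteqP; split=> [t [it Pt]|t [it ct]].
    by split => //; exact: subset_closure.
  split=> //; apply: Pclosed => [|e e0]; first by move: it; rewrite /= in_itv.
  have [s [[_ Ps] sb]] := ct (ball t e) (nbhsx_ballx t e e0).
  by exists s => //; move: sb; rewrite /ball /= distrC.
Qed.

End Segments.

(** * A branch with a locally injective fixed point is the identity *)

Section Identity.
Variable R : realType.
Local Notation C := ((R[i])^o).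
Variable f : C -> C.

Definition inj_at (w : R[i]) := exists2 d : R, 0 < d & forall x y : R[i],
  normc (x - w) < d -> normc (y - w) < d -> f x = f y -> x = y.

Hypothesis inj_nonreal : forall w : R[i], complex.Im w != 0 -> inj_at w.
Hypothesis inj_real_dense : forall x y : R, x < y -> exists2 t, x < t < y & inj_at t%:C.

Variables (D : set C) (phi : C -> C).
Hypothesis branch : aut_branch f D phi.

(** Asking for the identity on a whole disc makes the condition open, so that connectedness can
    propagate it. *)
Definition idnear (z : R[i]) :=
  exists2 e : R, 0 < e & forall y : R[i], normc (y - z) < e -> phi y = y.

Lemma idnear_id z : idnear z -> phi z = z.
Proof. by move=> [e e0]; apply; rewrite subrr normc0. Qed.

Lemma domain_ball (z : R[i]) : D z ->
  exists2 e : R, 0 < e & forall y : R[i], normc (y - z) < e -> D y.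
Proof.
move=> Dz; have [[oD _] _] := branch.
by have : nbhs (z : C) D by [move: oD; rewrite openE => /(_ _ Dz)] => /nbhs_normcP.
Qed.

Lemma branch_cont (z : R[i]) (e : R) : D z -> 0 < e -> exists2 d : R, 0 < d &
  forall y : R[i], normc (y - z) < d -> normc (phi y - phi z) < e.
Proof. by move=> Dz; case: branch => _ [H _]; exact: derivable_cont (H _ Dz) e. Qed.

(** By continuity [phi y] and [y] are both close to [z], and [f] takes the same value at them, so
    local injectivity identifies them. *)
Lemma fixed_idnear (z : R[i]) : D z -> phi z = z -> inj_at z -> idnear z.
Proof.
move=> Dz pz [d d0 Hd]; have [e e0 He] := domain_ball Dz.
have [e' e'0 He'] := branch_cont Dz d0.
exists (Num.min d (Num.min e e')) => [|y]; first by rewrite !lt_min d0 e0 e'0.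
rewrite !lt_min => /andP[yd /andP[ye ye']].
have [_ [_ fphi]] := branch.
by apply: Hd => //; [rewrite -[z in _ - z]pz; exact: He'|apply: fphi; exact: He].
Qed.

Lemma limit_fixed (z : R[i]) : D z ->
  (forall e : R, 0 < e -> exists2 y : R[i], normc (y - z) < e & phi y = y) -> phi z = z.
Proof.
move=> Dz H; apply/eqP; rewrite -subr_eq0 -normc_eq0; apply/negPn/negP => ne.
have n0 : 0 < normc (phi z - z) by rewrite lt_def ne normc_ge0.
have n2 : 0 < normc (phi z - z) / 2 by lra.
have [d d0 Hd] := branch_cont Dz n2.
have [|y] := H (Num.min d (normc (phi z - z) / 2)); first by rewrite lt_min d0.
rewrite lt_min => /andP[yd y2] py.
have := Hd y yd; rewrite py.
have := normc_dist_trans y (phi z) z; rewrite (normcB_sym (phi z) y); lra.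
Qed.

Lemma seg_idnear (a b : R[i]) : idnear a ->
  (forall t : R, 0 <= t <= 1 -> D (seg a b t) /\ inj_at (seg a b t)) -> idnear b.
Proof.
move=> ia H; rewrite -(seg1 a b).
have M0 : 0 < normc (b - a) + 1 by rewrite ltr_wpDl ?normc_ge0.
apply: (@seg_induction R (fun t => idnear (seg a b t))); first by rewrite seg0.
- move=> t [e e0 He]; exists (e / 2 / (normc (b - a) + 1)); first by rewrite !divr_gt0.
  move=> s; rewrite ltr_pdivlMr // => st; exists (e / 2); first by rewrite divr_gt0.
  move=> y ys; apply: He; apply: le_lt_trans (normc_dist_trans (seg a b s) _ _) _.
  have := normr_ge0 (s - t); rewrite seg_dist; lra.
- move=> t t01 Ht; have [Dt it] := H t t01; apply: fixed_idnear => //.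
  apply: limit_fixed => // e e0.
  have [|s] := Ht (e / (normc (b - a) + 1)); first by rewrite divr_gt0.
  rewrite ltr_pdivlMr // => st ist; exists (seg a b s); last exact: idnear_id.
  have := normr_ge0 (s - t); rewrite seg_dist; lra.
Qed.

(** At a nonreal [z] local injectivity suffices. Around a real [z] a disc inside [D] is filled along
    segments: from a nonreal point of [idnear] to a locally injective real point, from there to
    every nonreal point, and to the real points by continuity. *)
Lemma idnear_closed (z : R[i]) : D z ->
  (forall e : R, 0 < e -> exists2 y : R[i], normc (y - z) < e & idnear y) -> idnear z.
Proof.
move=> Dz H; have pz : phi z = z.
  by apply: limit_fixed => // e /H[y yz /idnear_id]; exists y.
have [z0|/inj_nonreal] := eqVneq (complex.Im z) 0; last exact: fixed_idnear.
have [e e0 He] := domain_ball Dz.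
have zE : z = (complex.Re z)%:C by case: (z) z0 => ? ? /= ->.
have [|z1 z1e [d d0 Hd]] := H e => //.
(* A real [z1] is moved up slightly, within its disc of identity and the disc around [z]. *)
have [z2 z2e [iz2 z20]] : exists2 z2 : R[i], normc (z2 - z) < e &
    idnear z2 /\ complex.Im z2 != 0.
  have [z10|z10] := eqVneq (complex.Im z1) 0; last first.
    by exists z1 => //; split=> //; exists d.
  pose k := Num.min d (e - normc (z1 - z)) / 2.
  have k0 : 0 < k by rewrite divr_gt0 // lt_min d0 subr_gt0.
  have kd : k <= d / 2 by rewrite ler_pM2r ?invr_gt0 // ge_min lexx.
  have ke : k <= (e - normc (z1 - z)) / 2 by rewrite ler_pM2r ?invr_gt0 // ge_min lexx orbT.
  have nk : normc (Complex 0 k) = k by rewrite /= expr0n add0r sqrtr_sqr gtr0_norm.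
  exists (z1 + Complex 0 k).
    have := normcD_le (z1 - z) (Complex 0 k); rewrite nk addrAC; lra.
  split; last by rewrite ImD z10 add0r /= gt_eqF.
  exists (d / 2); first lra.
  move=> y hy; apply: Hd; apply: le_lt_trans (normc_dist_trans (z1 + Complex 0 k) _ _) _.
  by rewrite (addrC z1) addrK nk; rewrite (addrC z1) in hy; lra.
have [|x xz ix] := @inj_real_dense (complex.Re z - e) (complex.Re z + e); first lra.
have xe : normc (x%:C - z) < e by rewrite zE -rmorphB normc_real ltr_norml; lra.
(* The segment from [z2] meets the real line only at its end [x]. *)
have idx : idnear x%:C.
  apply: (seg_idnear iz2) => t t01; split; first by apply: He; exact: seg_ball.
  have [->|t1] := eqVneq t 1; first by rewrite seg1.
  apply: inj_nonreal; rewrite Im_seg mulr0 addr0 mulf_neq0 //.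
  by rewrite subr_eq0 eq_sym.
have nonreal_id (y : R[i]) : normc (y - z) < e -> complex.Im y != 0 -> phi y = y.
  move=> ye y0; apply: idnear_id; apply: (seg_idnear idx) => t t01.
  split; first by apply: He; exact: seg_ball.
  have [->|t1] := eqVneq t 0; first by rewrite seg0.
  by apply: inj_nonreal; rewrite Im_seg mulr0 add0r mulf_neq0.
exists e => // y ye.
have [y0|y0] := eqVneq (complex.Im y) 0; last exact: nonreal_id.
apply: limit_fixed; first exact: He.
move=> g g0; pose k := Num.min g (e - normc (y - z)) / 2.
have k0 : 0 < k by rewrite divr_gt0 // lt_min g0 subr_gt0.
have kd : k <= g / 2 by rewrite ler_pM2r ?invr_gt0 // ge_min lexx.
have ke : k <= (e - normc (y - z)) / 2 by rewrite ler_pM2r ?invr_gt0 // ge_min lexx orbT.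
have nk : normc (Complex 0 k) = k by rewrite /= expr0n add0r sqrtr_sqr gtr0_norm.
exists (y + Complex 0 k); first by rewrite (addrC y) addrK nk; lra.
apply: nonreal_id.
  by have := normcD_le (y - z) (Complex 0 k); rewrite nk addrAC; lra.
by rewrite ImD y0 add0r /= gt_eqF.
Qed.

(** The points near which [phi] is the identity form a nonempty, relatively open and closed subset
    of the connected set [D]. *)
Lemma branch_id (w : R[i]) : D w -> phi w = w -> inj_at w ->
  forall z, D z -> phi z = z.
Proof.
move=> Dw pw iw.
have [[oD [cD _]] _] := branch.
suff E : D `&` [set z | idnear z] = D.
  by move=> z; rewrite -{1}E => -[_ /idnear_id].
apply: cD.
- by exists w; split=> //; exact: fixed_idnear.
- exists [set z | idnear z] => //; rewrite openE => z [e e0 He].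
  apply/nbhs_normcP; exists (e / 2); first by rewrite divr_gt0.
  move=> y yz; exists (e / 2); first by rewrite divr_gt0.
  move=> x xy; apply: He; apply: le_lt_trans (normc_dist_trans y _ _) _; lra.
- exists (closure (D `&` [set z | idnear z])); first exact: closed_closure.
  apply/seteqP; split=> [z Sz|z [Dz cz]].
    by split; [case: Sz|exact: subset_closure].
  split=> //; apply: idnear_closed => // e e0.
  have [|y [[_ iy] yz]] := cz [set y | normc (y - z) < e].
    by apply/nbhs_normcP; exists e.
  by exists y.
Qed.

End Identity.

(** * Discs, a mean value inequality, contractions and implicit differentiation *)

Section Discs.
Variable R : realType.
Local Notation C := ((R[i])^o).

Lemma disc_domain (t : C) (d : R) : 0 < d -> domain [set z : C | normc (z - t) < d].
Proof.
move=> d0; have oD : open [set z : C | normc (z - t) < d].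
  rewrite openE => z /= zt; apply/nbhs_normcP.
  exists (d - normc (z - t)); first by rewrite subr_gt0.
  by move=> y yz; apply: le_lt_trans (normc_dist_trans z _ _) _; lra.
split=> //; split; last by exists t; rewrite /= subrr normc0.
move=> B [b Bb] [U oU BU] [Z cZ BZ].
have Db : normc (b - t) < d by move: Bb; rewrite BU => -[].
rewrite BU; apply/seteqP; split=> [z []//|z /= Dz]; split=> //.
have M0 : 0 < normc (z - b) + 1 by rewrite ltr_wpDl ?normc_ge0.
rewrite -(seg1 b z).
apply: (@seg_induction R (fun s => U (seg b z s))).
- by rewrite seg0; move: Bb; rewrite BU => -[].
- move=> s Us; have /nbhs_normcP[e e0 He] : nbhs (seg b z s : C) U.
    by move: oU; rewrite openE => /(_ _ Us).
  exists (e / (normc (z - b) + 1)); first by rewrite divr_gt0.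
  move=> s'; rewrite ltr_pdivlMr // => ss'; apply: He.
  by have := normr_ge0 (s' - s); rewrite seg_dist; lra.
- move=> s s01 Hs; have Ds := seg_ball Db Dz s01.
  suff : B (seg b z s) by rewrite BU => -[].
  rewrite BZ; split=> //; apply: cZ => A /nbhs_normcP[e e0 He].
  have [|s' ss' Us'] := Hs (Num.min e (d - normc (seg b z s - t)) / (normc (z - b) + 1)).
    by rewrite divr_gt0 // lt_min e0 subr_gt0.
  move: ss'; rewrite ltr_pdivlMr // lt_min => /andP[se sd].
  have n0 := normr_ge0 (s' - s); have sd' := seg_dist b z s' s.
  exists (seg b z s'); split; last by apply: He; rewrite sd'; lra.
  suff : B (seg b z s') by rewrite BZ => -[].
  rewrite BU; split=> //=; have := normc_dist_trans (seg b z s) (seg b z s') t.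
  rewrite sd'; lra.
Qed.

Lemma seg_normc_le (a b : R[i]) (rho s : R) : normc a <= rho -> normc b <= rho ->
  0 <= s <= 1 -> normc (seg a b s) <= rho.
Proof.
move=> ar br /andP[s0 s1].
have -> : seg a b s = (1 - s)%:C * a + s%:C * b.
  by rewrite /seg rmorphB rmorph1; ring.
apply: le_trans (normcD_le _ _) _; rewrite !normcM !normc_real !ger0_norm ?subr_ge0 //.
have h1 : (1 - s) * normc a <= (1 - s) * rho by rewrite ler_wpM2l // subr_ge0.
have h2 : s * normc b <= s * rho by rewrite ler_wpM2l.
lra.
Qed.

(** The segment is cut into [N + 1] equal steps. The linear terms add up to at most [M] times its
    length, the quadratic errors to a quantity of order [1 / (N + 1)]. *)
Lemma mean_value (H H' : R[i] -> R[i]) (rho M K d : R) : 0 < d ->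
  (forall u, normc u <= rho -> normc (H' u) <= M) ->
  (forall u h, normc u <= rho -> normc h <= d ->
     normc (H (u + h) - H u - H' u * h) <= K * normc h ^+ 2) ->
  forall u v, normc u <= rho -> normc v <= rho -> normc (H u - H v) <= M * normc (u - v).
Proof.
move=> d0 HM HK u v ur vr.
set L := normc (u - v); have L0 : 0 <= L := normc_ge0 _.
have step N k : (k <= N.+1)%N -> L <= d * N.+1%:R ->
    normc (H (seg v u (k%:R / N.+1%:R)) - H v) <=
      k%:R * (M * L / N.+1%:R + K * L ^+ 2 / N.+1%:R ^+ 2).
  move=> + LN; have N0 : 0 < N.+1%:R :> R by [].
  elim: k => [_|k IH kN]; first by rewrite mul0r seg0 subrr normc0 mul0r.
  have {}IH := IH (ltnW kN).
  set p := seg v u (k%:R / N.+1%:R) in IH.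
  have pr : normc p <= rho.
    have k1 : k%:R / N.+1%:R <= (1 : R) by rewrite ler_pdivrMr // mul1r ler_nat ltnW.
    have k0 : (0 : R) <= k%:R / N.+1%:R by rewrite divr_ge0.
    by apply: seg_normc_le => //; rewrite k0 k1.
  pose h : R[i] := (N.+1%:R^-1 : R)%:C * (u - v).
  have nh : normc h = L / N.+1%:R.
    by rewrite normcM normc_real ger0_norm ?invr_ge0 // mulrC.
  have -> : seg v u (k.+1%:R / N.+1%:R) = p + h.
    by rewrite /p /h /seg -natr1 mulrDl rmorphD mulrDl mul1r addrA.
  have hd : normc h <= d by rewrite nh ler_pdivrMr.
  have E : normc (H (p + h) - H p - H' p * h) <= K * L ^+ 2 / N.+1%:R ^+ 2.
    by apply: le_trans (HK p h pr hd) _; rewrite nh expr_div_n -mulrA.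
  have E' : normc (H' p * h) <= M * L / N.+1%:R.
    rewrite normcM nh -mulrA; apply: ler_wpM2r; last exact: HM.
    by rewrite divr_ge0.
  have -> : H (p + h) - H v = (H (p + h) - H p - H' p * h) + (H' p * h + (H p - H v)) by ring.
  apply: le_trans (normcD_le _ _) _.
  have := normcD_le (H' p * h) (H p - H v).
  rewrite -(natr1 k) (mulrDl k%:R) mul1r.
  set X := M * L / _ in E' IH *; set Y := K * _ / _ in E IH *.
  set Z := k%:R * _ in IH *; lra.
apply/ler_addgt0Pr => e e0.
(* The first summand makes the steps no longer than [d], the second makes the total error at most
   [e]. *)
pose N := Num.bound (L / d + `|K| * L ^+ 2 / e).
have NB : L / d + `|K| * L ^+ 2 / e < N.+1%:R.
  apply: lt_trans (archi_boundP _) _; last by rewrite ltr_nat.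
  by rewrite addr_ge0 ?divr_ge0 ?mulr_ge0 ?sqr_ge0 ?(ltW d0) ?(ltW e0).
have N0 : 0 < N.+1%:R :> R by [].
have LN : L <= d * N.+1%:R.
  rewrite mulrC -ler_pdivrMr //; apply: le_trans (ltW NB); rewrite lerDl.
  by rewrite divr_ge0 ?mulr_ge0 ?sqr_ge0 ?(ltW e0).
have KN : `|K| * L ^+ 2 / N.+1%:R <= e.
  rewrite ler_pdivrMr // (mulrC e) -ler_pdivrMr //; apply: le_trans (ltW NB); rewrite lerDr.
  by rewrite divr_ge0 ?(ltW d0).
have := step N N.+1 (leqnn _) LN; rewrite divff ?pnatr_eq0 // seg1 => /le_trans; apply.
have -> : N.+1%:R * (M * L / N.+1%:R + K * L ^+ 2 / N.+1%:R ^+ 2) =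
   M * L + K * L ^+ 2 / N.+1%:R :> R by field; rewrite gt_eqF.
rewrite lerD2l; apply: le_trans KN; rewrite ler_wpM2r ?invr_ge0 //.
by rewrite ler_wpM2r ?exprn_ge0 // ler_norm.
Qed.

(** Successive differences of the iterates shrink geometrically, so their series converges
    absolutely and the iterates have a limit, which is fixed because [T] is a contraction. *)
Lemma half_contraction_fixpoint (T : R[i] -> R[i]) (z0 : R[i]) (rho : R) : 0 <= rho ->
  (forall v, normc (v - z0) <= rho -> normc (T v - z0) <= rho) ->
  (forall v v', normc (v - z0) <= rho -> normc (v' - z0) <= rho ->
     normc (T v - T v') <= 1 / 2 * normc (v - v')) ->
  exists2 v, normc (v - z0) <= rho & T v = v.
Proof.
move=> rho0 Tin Tc; pose x n := iter n T z0.
have xin n : normc (x n - z0) <= rho.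
  by elim: n => [|n IH]; [rewrite subrr normc0|exact: Tin].
have xs n : normc (x n.+1 - x n) <= rho * (1 / 2) ^+ n.
  elim: n => [|n IH]; first by rewrite expr0 mulr1; exact: xin 1%N.
  apply: le_trans (Tc _ _ (xin n.+1) (xin n)) _; rewrite exprS; lra.
have [|l Hl] := @abs_bsum_cvg R (fun n => x n.+1 - x n).
  exists (2 * rho) => N.
  suff : \sum_(n < N) normc (x n.+1 - x n) <= 2 * rho - 2 * rho * (1 / 2) ^+ N.
    have : 0 <= rho * (1 / 2) ^+ N by rewrite mulr_ge0 // exprn_ge0.
    lra.
  elim: N => [|N IH]; first by rewrite big_ord0 expr0; lra.
  by rewrite big_ord_recr /= exprS; have := xs N; lra.
have tele N : \sum_(n < N) (x n.+1 - x n) = x N - z0.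
  elim: N => [|N IH]; first by rewrite big_ord0 subrr.
  by rewrite big_ord_recr /= IH addrC addrA subrK.
have xl e : 0 < e -> exists N, forall n, (N <= n)%N -> normc (x n - (z0 + l)) < e.
  move=> e0; have /cvg_normcP/(_ e e0)[N _ HN] := Hl.
  exists N => n Nn; have := HN n Nn; rewrite tele /=.
  by have -> : x n - z0 - l = x n - (z0 + l) by ring.
have vin : normc (z0 + l - z0) <= rho.
  apply/ler_addgt0Pr => e /xl[N /(_ N (leqnn N)) HN].
  by have := normc_dist_trans (x N) (z0 + l) z0; rewrite (normcB_sym (z0 + l) (x N)); have := xin N; lra.
exists (z0 + l) => //; apply/eqP; rewrite -subr_eq0 -normc_eq0 eq_le normc_ge0 andbT.
apply/ler_addgt0Pr => e e0; rewrite add0r.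
have e2 : 0 < e / 2 by lra.
have [N HN] := xl _ e2.
have h1 := HN N (leqnn N); have h2 := HN N.+1 (leqnSn N).
have := Tc _ _ vin (xin N); rewrite (normcB_sym (z0 + l)) => h3.
by have := normc_dist_trans (x N.+1) (T (z0 + l)) (z0 + l); rewrite -[x N.+1]/(T (x N)) in h2 *; lra.
Qed.

(** Differentiates [F (phi y) = F y]: continuity of [phi] makes the expansion of [F] at [phi z]
    available, and solving for the increment of [phi] gives the derivative [d1 / d2]. *)
Lemma implicit_derivable (F phi : C -> C) (z : C) :
  derivable F z 1 ->
  (exists2 d2 : C, d2 != 0 & forall e : R, 0 < e -> exists2 s : R, 0 < s &
     forall k : C, normc k < s -> normc (F (phi z + k) - F (phi z) - d2 * k) <= e * normc k) ->
  (exists2 s : R, 0 < s & forall y : C, normc (y - z) < s -> F (phi y) = F y) ->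
  (forall e : R, 0 < e -> exists2 s : R, 0 < s &
     forall y : C, normc (y - z) < s -> normc (phi y - phi z) < e) ->
  derivable phi z 1.
Proof.
move=> /derivable_normcP[d1 H1] [d2 d20 H2] [s0 s00 Fphi] Hc.
apply/derivable_normcP; exists (d1 / d2) => e e0.
have D2 : 0 < normc d2 by rewrite normc_gt0.
set n2 := normc d2 in D2; set n1 := normc d1.
have n10 : 0 <= n1 := normc_ge0 _.
(* An a priori bound for the difference quotient [q] of [phi], from [n2 * normc q <= n2 / 2 * normc
   q + 1 + n1]. *)
pose Q := 2 * (n1 + 1) / n2.
have Q0 : 0 < Q by rewrite divr_gt0 // mulr_gt0 // ltr_wpDl.
(* Both [e1 * Q] and [e2] are at most [e * n2 / 4]; the other bounds serve the estimate of [q]. *)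
pose e1 := Num.min (n2 / 2) (e * n2 / (4 * Q)).
pose e2 := Num.min 1 (e * n2 / 4).
have eN := mulr_gt0 e0 D2.
have Q4 : 0 < 4 * Q by lra.
have e10 : 0 < e1 by rewrite lt_min; apply/andP; split; [lra|exact: divr_gt0].
have e20 : 0 < e2 by rewrite lt_min; apply/andP; split; lra.
have e1a : e1 <= n2 / 2 by rewrite ge_min lexx.
have e1b : e1 * (4 * Q) <= e * n2 by rewrite -ler_pdivlMr // ge_min lexx orbT.
have e2a : e2 <= 1 by rewrite ge_min lexx.
have e2b : e2 <= e * n2 / 4 by rewrite ge_min lexx orbT.
have [r1 r10 Hr1] := H1 e2 e20.
have [r2 r20 Hr2] := H2 e1 e10.
have [r3 r30 Hr3] := Hc r2 r20.
exists (Num.min s0 (Num.min r1 r3)); first by rewrite !lt_min s00 r10 r30.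
move=> h h0; rewrite !lt_min => /andP[hs /andP[hr1 hr3]].
have zh : z + h - z = h by rewrite (addrC z) addrK.
have k2 : normc (phi (z + h) - phi z) < r2 by apply: Hr3; rewrite zh.
have pz : F (phi z) = F z by apply: Fphi; rewrite subrr normc0.
have pzh : F (phi (z + h)) = F (z + h) by apply: Fphi; rewrite zh.
have := Hr2 _ k2; rewrite (addrC (phi z)) subrK pz pzh => A.
have B := Hr1 h h0 hr1.
set k := phi (z + h) - phi z in A k2 *; set y := F (z + h) - F z in A B.
pose q : R[i] := h^-1 * k.
have kq : k = h * q by rewrite /q mulrA divff // mul1r.
have nh : 0 < normc h by rewrite normc_gt0.
have A' : normc (h^-1 * y - d2 * q) <= e1 * normc q.
  rewrite -(ler_pM2l nh) -normcM.
  have -> : h * (h^-1 * y - d2 * q) = y - d2 * k :> R[i].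
    by rewrite kq mulrBr (mulrA h h^-1) divff // mul1r (mulrCA h).
  by apply: le_trans A _; rewrite kq normcM mulrCA.
have B' : normc (d2 * q - d1) <= e1 * normc q + e2.
  have := normc_dist_trans (h^-1 * y) (d2 * q) d1.
  rewrite (normcB_sym (d2 * q) (h^-1 * y)) => /le_trans; apply; apply: lerD => //.
  exact: ltW B.
have q0 := normc_ge0 q.
have qQ : normc q <= Q.
  rewrite /Q ler_pdivlMr //.
  have : normc (d2 * q) <= normc (d2 * q - d1) + n1.
    by have := normcD_le (d2 * q - d1) d1; rewrite subrK.
  rewrite normcM -/n2; nra.
have -> : h^-1 * k - d1 / d2 = (d2 * q - d1) / d2 :> R[i].
  by rewrite mulrBl -/q mulrAC divff // mul1r.
rewrite normc_div ltr_pdivrMr //; apply: le_lt_trans B' _.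
have h1 : e1 * normc q <= e1 * Q by rewrite ler_pM2l.
rewrite mulrCA in e1b; move: (e1 * Q) (e1 * normc q) (e * n2) e1b h1 eN e2b => X Y Z.
lra.
Qed.

End Discs.

(** * The non-identity branch at a point where [f] is quadratic to leading order *)

Section Involution.
Variable R : realType.
Local Notation C := ((R[i])^o).
Implicit Types u v w z : R[i].
Variables (f : C -> C) (t a : R[i]) (C0 d : R).
Hypothesis fE : entire f.
Hypothesis a0 : a != 0.
Hypothesis C00 : 0 <= C0.
Hypothesis quad : forall (rho : R) (u v : R[i]), rho <= d -> normc u <= rho -> normc v <= rho ->
  normc (f (t + u) - f (t + v) - a * ((u - v) * (u + v)) : R[i]) <=
    C0 * rho ^+ 2 * normc (u - v).

Local Notation A := (normc a).
Variable delta : R.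
Hypothesis delta0 : 0 < delta.
Hypothesis delta_d : delta <= d / 2.
Hypothesis delta_A : delta * (32 * (C0 + 1)) <= A.

Let A0 : 0 < A. Proof. by rewrite normc_gt0. Qed.

(** Uses [quad] with radius [2 * normc u]; the choice of [delta] turns its coefficient
    [4 * C0 * normc u ^+ 2] into a small part of [A * normc u], the scale of the main term. *)
Lemma quad_near u v v' : normc u <= delta -> normc v <= 2 * normc u -> normc v' <= 2 * normc u ->
  normc (f (t + v) - f (t + v') - a * ((v - v') * (v + v')) : R[i]) <=
    A / 8 * normc u * normc (v - v').
Proof.
move=> ud vu v'u; apply: le_trans (quad _ vu v'u) _; first by move: delta_d; lra.
apply: ler_wpM2r; first exact: normc_ge0.
have n0 := normc_ge0 u; have dA := delta_A; have c0 := C00.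
have h : 32 * (C0 * normc u) <= A by nra.
have := ler_wpM2r n0 h; lra.
Qed.

Lemma quad_near4 u v v' : normc u <= delta -> normc v <= 2 * normc u -> normc v' <= 2 * normc u ->
  normc (f (t + v) - f (t + v') - a * ((v - v') * (v + v')) : R[i]) <=
    4 * C0 * normc u ^+ 2 * normc (v - v').
Proof.
move=> ud vu v'u; apply: le_trans (quad _ vu v'u) _; first by move: delta_d; lra.
by rewrite le_eqVlt; apply/orP; left; apply/eqP; ring.
Qed.

Lemma near_opp_le u v : normc (v + u) <= normc u / 4 -> normc v <= 2 * normc u.
Proof.
by move=> vu; have := normcB_le (v + u) u; rewrite addrK; have := normc_ge0 u; lra.
Qed.

(** Newton iteration for [f (t + v) = f (t + u)] with the derivative frozen at [- 2 * a * u], its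
    leading value at [v = - u]; it contracts the disc of radius [normc u / 4] around [- u]. *)
Lemma opp_solution_exists u : normc u <= delta ->
  exists2 v : R[i], normc (v + u) <= normc u / 4 & f (t + v) = f (t + u).
Proof.
move=> ud; have [->|u0] := eqVneq u 0.
  by exists 0; rewrite ?addr0 ?normc0 ?mul0r.
have n0 : 0 < normc u by rewrite normc_gt0.
pose T v : R[i] := v + (f (t + v) - f (t + u)) / (2 * a * u).
have au : 2 * a * u != 0 by rewrite !mulf_neq0 // pnatr_eq0.
have nau : normc (2 * a * u) = 2 * A * normc u.
  by rewrite !normcM; congr (_ * _ * _); rewrite -(rmorph_nat (real_complex R) 2) normc_real ger0_norm.
have nau0 : 0 < normc (2 * a * u) by rewrite normc_gt0.
have Tc v v' : normc (v - - u) <= normc u / 4 -> normc (v' - - u) <= normc u / 4 ->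
    normc (T v - T v') <= 1 / 2 * normc (v - v').
  rewrite !opprK => vu v'u.
  have E := quad_near ud (near_opp_le vu) (near_opp_le v'u).
  set err := (X in normc X) in E.
  have -> : T v - T v' = (v - v') * ((v + u) + (v' + u)) / (2 * u) + err / (2 * a * u).
    by rewrite /T /err; field; rewrite a0 u0.
  apply: le_trans (normcD_le _ _) _.
  have h1 : normc (err / (2 * a * u)) <= 1 / 16 * normc (v - v').
    rewrite normc_div ler_pdivrMr // nau; apply: le_trans E _.
    by rewrite le_eqVlt; apply/orP; left; apply/eqP; field.
  have n2u : normc (2 * u) = 2 * normc u.
    by rewrite !normcM; congr (_ * _); rewrite -(rmorph_nat (real_complex R) 2) normc_real ger0_norm.
  have h2 : normc ((v - v') * ((v + u) + (v' + u)) / (2 * u)) <= 1 / 4 * normc (v - v').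
    rewrite normc_div n2u ler_pdivrMr; last lra.
    rewrite normcM.
    have h3 : normc ((v + u) + (v' + u)) <= normc u / 2.
      by have := normcD_le (v + u) (v' + u); lra.
    apply: le_trans (ler_wpM2l (normc_ge0 _) h3) _.
    by rewrite le_eqVlt; apply/orP; left; apply/eqP; field.
  by have := normc_ge0 (v - v'); lra.
have Tu : normc (T (- u) + u) <= normc u / 8.
  have nu : normc (- u) <= 2 * normc u by rewrite normc_opp; lra.
  have nu' : normc u <= 2 * normc u by lra.
  have := quad_near ud nu nu'; rewrite addNr !mulr0 subr0 => E.
  have -> : T (- u) + u = (f (t - u) - f (t + u)) / (2 * a * u) by rewrite /T; ring.
  rewrite normc_div ler_pdivrMr // nau; apply: le_trans E _.
  rewrite -opprD normc_opp normc_double.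
  by rewrite le_eqVlt; apply/orP; left; apply/eqP; field.
have [| |v vin Tv] := @half_contraction_fixpoint R T (- u) (normc u / 4) _ _ Tc.
- lra.
- move=> v vin; have uin : normc (- u - - u) <= normc u / 4 by rewrite subrr normc0; lra.
  have := Tc _ _ vin uin; have := normcD_le (T v - T (- u)) (T (- u) + u).
  rewrite addrA subrK !opprK in vin *; lra.
exists v; first by rewrite opprK in vin.
move: Tv => /eqP; rewrite /T -subr_eq0 addrAC subrr add0r mulf_eq0 invr_eq0 (negPf au) orbF.
by rewrite subr_eq0 => /eqP.
Qed.

(** For equal values [a * (v - u) * (v + u)] is itself the error term; if [u] is not 0, dividing by
    [v - u] bounds [v + u]. The 1/8 leaves room in [opp_sum_ge], and the quadratic bound gives the
    derivative at [t]. *)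
Lemma opp_solution_close u v : normc u <= delta -> normc (v + u) <= normc u / 4 ->
  f (t + v) = f (t + u) ->
  normc (v + u) <= normc u / 8 /\ normc (v + u) <= 4 * C0 / A * normc u ^+ 2.
Proof.
move=> ud vu fv; have [u0|u0] := eqVneq u 0.
  move: vu; rewrite u0 normc0 mul0r => vu; split; first lra.
  by rewrite expr0n mulr0.
have n0 : 0 < normc u by rewrite normc_gt0.
have vu' := near_opp_le vu; have uu : normc u <= 2 * normc u by lra.
have w0 : 0 < normc (v - u).
  have := normcB_ge (u + u) (v + u).
  have -> : u + u - (v + u) = - (v - u) by ring.
  rewrite normc_opp normc_double; lra.
have := quad_near ud vu' uu; have := quad_near4 ud vu' uu.
rewrite fv subrr sub0r normc_opp !normcM => h1 h2; split.
- have : A * normc (v + u) <= A * (normc u / 8) by rewrite -(ler_pM2r w0); lra.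
  by rewrite ler_pM2l.
- rewrite mulrAC ler_pdivlMr //.
  have : normc (v + u) * A <= 4 * C0 * normc u ^+ 2 by rewrite -(ler_pM2r w0); lra.
  by [].
Qed.

Section Branch.
Variable v : R[i] -> R[i].
Hypothesis vP : forall u, normc u <= delta ->
  normc (v u + u) <= normc u / 4 /\ f (t + v u) = f (t + u).

(** Here [v] is an arbitrary selection of solutions, so the regularity of [phi] has to come from the
    estimates. *)
Let phi : C -> C := fun z => t + v (z - t).

Lemma branch0 : v 0 = 0.
Proof.
have [|h _] := vP (u := 0); first by rewrite normc0 ltW.
by apply: eq0_normc; apply/le_anti; move: h; rewrite addr0 normc0 mul0r normc_ge0 => ->.
Qed.

Lemma branch_derivable_center : derivable phi t 1.
Proof.
apply/derivable_normcP; exists (-1) => e e0.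
have K0 : 0 < 4 * C0 / A + 1 by rewrite ltr_wpDl // divr_ge0 ?normc_ge0 // mulr_ge0.
exists (Num.min delta (e / (4 * C0 / A + 1))); first by rewrite lt_min delta0 divr_gt0.
move=> h h0; rewrite lt_min => /andP[hd he].
have hd' := ltW hd; have [h4 fh] := vP hd'.
have [_ hC] := opp_solution_close hd' h4 fh.
have n0 : 0 < normc h by rewrite normc_gt0.
rewrite ltr_pdivlMr // in he.
have -> : h^-1 * (phi (t + h) - phi t) - (-1) = (v h + h) / h :> R[i].
  by rewrite /phi (addrC t h) addrK subrr branch0; field.
rewrite normc_div ltr_pdivrMr //; apply: le_lt_trans hC _; rewrite expr2 mulrA ltr_pM2r //.
by apply: le_lt_trans he; rewrite mulrDr mulr1 mulrC lerDl ltW.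
Qed.

(** Both [v u] and [v u0] are close to [- u0], so their sum is close to [- 2 * u0] and stays away
    from 0. *)
Lemma opp_sum_ge u u0 : u0 != 0 -> normc u0 <= delta -> normc u <= delta ->
  normc (u - u0) <= normc u0 / 8 ->
  [/\ normc (v u0) <= 2 * normc u0, normc (v u) <= 2 * normc u0,
    7 / 8 * normc u0 <= normc (v u0) & 3 / 2 * normc u0 <= normc (v u + v u0)].
Proof.
move=> u00 d1 d2 uu0; have n0 : 0 < normc u0 by rewrite normc_gt0.
have [a1 a2] := vP d1; have [b1 b2] := vP d2.
have [a3 _] := opp_solution_close d1 a1 a2.
have [b3 _] := opp_solution_close d2 b1 b2.
have nu : normc u <= 9 / 8 * normc u0.
  by have := normcD_le (u - u0) u0; rewrite subrK; lra.
have c1 := normcB_le (v u0 + u0) u0; rewrite addrK in c1.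
have c2 := normcB_le (v u + u) u; rewrite addrK in c2.
have c3 := normcB_ge u0 (v u0 + u0).
rewrite (_ : u0 - (v u0 + u0) = - v u0) in c3; last by ring.
rewrite normc_opp in c3.
have c4 : 2 * normc u0 - normc (u - u0) <= normc (u + u0).
  rewrite -normc_double; apply: le_trans (normcD_ge (u0 + u0) (u - u0)) _.
  by rewrite le_eqVlt; apply/orP; left; apply/eqP; congr normc; ring.
have c5 := normcB_ge (u + u0) ((v u + u) + (v u0 + u0)).
rewrite (_ : u + u0 - (v u + u + (v u0 + u0)) = - (v u + v u0)) in c5; last by ring.
rewrite normc_opp in c5.
have c6 := normcD_le (v u + u) (v u0 + u0).
by split; lra.
Qed.

(** An inverse Lipschitz bound: the main term is at least 3/2 of [A * normc u0 * normc (x - v u0)],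
    the error at most 1/8 of the same quantity. *)
Lemma f_sub_ge u0 x : u0 != 0 -> normc u0 <= delta ->
  normc x <= 2 * normc u0 -> normc (v u0) <= 2 * normc u0 ->
  3 / 2 * normc u0 <= normc (x + v u0) ->
  A * normc u0 * normc (x - v u0) <= normc (f (t + x) - f (t + v u0) : R[i]).
Proof.
move=> u00 d1 h1 h2 h3; have n0 : 0 < normc u0 by rewrite normc_gt0.
have E := quad_near d1 h1 h2.
have := normcD_ge (a * ((x - v u0) * (x + v u0)))
   (f (t + x) - f (t + v u0) - a * ((x - v u0) * (x + v u0)) : R[i]).
rewrite addrCA subrr addr0 !normcM => F; apply: le_trans F.
have w0 := normc_ge0 (x - v u0).
have := mulr_ge0 (ltW A0) w0.
have : A * normc (x - v u0) * (3 / 2 * normc u0) <= A * normc (x - v u0) * normc (x + v u0).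
  by rewrite ler_wpM2l // mulr_ge0 // ltW.
have : 0 <= A * normc (x - v u0) * normc u0 by rewrite !mulr_ge0 // ltW.
lra.
Qed.

(** Away from the centre [f_sub_ge] supplies two inputs of [implicit_derivable]: the derivative of
    [f] at [phi z] is not 0, and [phi] is continuous at [z]. *)
Lemma branch_derivable (z : C) : normc (z - t) < delta -> derivable phi z 1.
Proof.
move=> zd; have [zt|u00] := eqVneq (z - t : R[i]) 0.
  by move/eqP: zt; rewrite subr_eq0 => /eqP ->; exact: branch_derivable_center.
set u0 : R[i] := z - t in zd u00.
have n0 : 0 < normc u0 by rewrite normc_gt0.
have zE : z = t + u0 by rewrite /u0 addrC subrK.
have ud := ltW zd; have [v1 v2] := vP ud.
have An : 0 < A * normc u0 by rewrite mulr_gt0.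
have self : normc (u0 - u0) <= normc u0 / 8 by rewrite subrr normc0 divr_ge0 // ltW.
have [g1 _ g2 _] := opp_sum_ge u00 ud ud self.
apply: (@implicit_derivable R f phi z).
- exact: fE.
- have /derivable_normcP[d2 H2] := @fE (phi z).
  have H2' e : 0 < e -> exists2 s : R, 0 < s & forall k : C, normc k < s ->
     normc (f (phi z + k) - f (phi z) - d2 * k) <= e * normc k.
    move=> /H2[s s0 Hs]; exists s => // k ks.
    have [->|k0] := eqVneq k 0; first by rewrite addr0 mulr0 !subrr normc0 mulr0.
    have -> : f (phi z + k) - f (phi z) - d2 * k =
        k * (k^-1 * (f (phi z + k) - f (phi z)) - d2) :> R[i] by field.
    by rewrite (normcM k) mulrC ler_wpM2r ?normc_ge0 // ltW // Hs.
  exists d2 => //; apply/eqP => d20; rewrite d20 in H2'.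
  (* With derivative 0, small increments of [f] would be at most half of what [f_sub_ge]
     guarantees. *)
  have [|s s0 Hs] := H2' (A * normc u0 / 2); first by rewrite divr_gt0.
  pose r := Num.min s (normc u0 / 8) / 2.
  have r0 : 0 < r by rewrite divr_gt0 // lt_min s0 divr_gt0.
  have rs : r <= s / 2 by rewrite ler_pM2r ?invr_gt0 // ge_min lexx.
  have ru : r <= normc u0 / 8 / 2 by rewrite ler_pM2r ?invr_gt0 // ge_min lexx orbT.
  have nr : normc r%:C = r by rewrite normc_real gtr0_norm.
  have := Hs r%:C; rewrite nr mul0r subr0 => /(_ _) Hr.
  have {}Hr : normc (f (t + (v u0 + r%:C)) - f (t + v u0) : R[i]) <= A * normc u0 / 2 * r.
    by rewrite addrA; apply: Hr; lra.
  have [a1 a2] := vP ud; have [a3 _] := opp_solution_close ud a1 a2.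
  have x1 : normc (v u0 + r%:C) <= 2 * normc u0.
    have := normcD_le (v u0) r%:C; have := normcB_le (v u0 + u0) u0.
    by rewrite addrK nr; lra.
  have x2 : 3 / 2 * normc u0 <= normc (v u0 + r%:C + v u0).
    have := normcD_ge (v u0 + v u0) r%:C; rewrite normc_double nr addrAC; lra.
  have := f_sub_ge u00 ud x1 g1 x2; rewrite (addrC (v u0)) addrK nr (addrC _ (v u0)).
  have := mulr_gt0 An r0; lra.
- exists (delta - normc u0); first by rewrite subr_gt0.
  move=> y yz; have yd : normc (y - t) <= delta.
    by have := normc_dist_trans z y t; rewrite -/u0; lra.
  by have [_ ->] := vP yd; rewrite (addrC t) subrK.
- move=> e e0.
  have [s s0 Hs] := derivable_cont (@fE z) (mulr_gt0 e0 An).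
  exists (Num.min s (Num.min (normc u0 / 8) (delta - normc u0))).
    by rewrite !lt_min s0 subr_gt0 zd divr_gt0.
  move=> y; rewrite !lt_min => /andP[ys /andP[y8 yd]].
  have yd' : normc (y - t) <= delta by have := normc_dist_trans z y t; rewrite -/u0; lra.
  have uu : normc ((y - t) - u0) <= normc u0 / 8.
    rewrite (_ : y - t - u0 = y - z :> R[i]); last by rewrite /u0; ring.
    exact: ltW.
  have [_ h1 _ h2] := opp_sum_ge u00 ud yd' uu.
  have := f_sub_ge u00 ud h1 g1 h2.
  have [_ ->] := vP yd'; rewrite v2 -zE (addrC t (y - t)) subrK.
  have := Hs y ys; rewrite /phi -/u0.
  rewrite (_ : t + v (y - t) - (t + v u0) = v (y - t) - v u0 :> R[i]); last by ring.
  move=> f1 f2; rewrite -(ltr_pM2r An) mulrC; exact: le_lt_trans f2 f1.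
Qed.

End Branch.

(** The branch is not the identity, because [v u = u] would give [2 * normc u <= normc u / 4], which
    fails for nonzero [u]. *)
Lemma quadratic_point_FixAut : FixAut f t.
Proof.
have [v vP] : exists v : R[i] -> R[i], forall u, normc u <= delta ->
    normc (v u + u) <= normc u / 4 /\ f (t + v u) = f (t + u).
  have H u : exists x : R[i], normc u <= delta ->
      normc (x + u) <= normc u / 4 /\ f (t + x) = f (t + u).
    have [/opp_solution_exists[x x1 x2]|ud] := leP (normc u) delta; first by exists x.
    (* Outside the disc the value 0 is an arbitrary default. *)
    by exists 0.
  by have [v Hv] := choice H; exists v.
exists [set z : C | normc (z - t) < delta], (fun z => t + v (z - t)); split.
- split; first exact: disc_domain.
  split=> z /= zd; first exact: branch_derivable.
  by have [_ ->] := vP _ (ltW zd); rewrite addrC subrK.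
- by rewrite /= subrr normc0.
- have nd : normc (delta / 2)%:C = delta / 2 by rewrite normc_real gtr0_norm // divr_gt0.
  have td : t + (delta / 2)%:C - t = (delta / 2)%:C by rewrite addrC addKr.
  have dd := delta0; exists (t + (delta / 2)%:C); first by rewrite /= td nd; lra.
  apply/eqP; rewrite td => /addrI E.
  have [|h _] := vP (delta / 2)%:C; first by rewrite nd; lra.
  by move: h; rewrite E normc_double nd; lra.
- by rewrite subrr (branch0 vP) addr0.
Qed.

End Involution.

(** * Critical points of [f]: quadratic behaviour and maxima of the modulus *)

Section LaguerrePolya.
Variables (R : realType) (m : nat) (r : nat -> R) (c b : R[i]).
Local Notation C := ((R[i])^o).
Implicit Types (z w h u : R[i]) (n N : nat).

Local Notation zq := (zq m r).
Local Notation sres := (sres m r).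
Local Notation rsres := (rsres m r).
Local Notation regular := (regular m r).
Local Notation cprod := (cprod m r c b).
Local Notation logder := (logder m r b).

Hypothesis r2 : bsum (fun n => r n ^+ 2).
Hypothesis c0 : c != 0.
Variable f : C -> C.
Hypothesis flim : forall z : R[i], (fun N => (cprod N z : C)) @ \oo --> (f z : C).

(** Adding [f t * S2 / 2 * u ^+ 2] to [f (t + u)] removes the second-order term: the derivative of
    the sum is of order [u ^+ 2], since [logder (t + u)] is [- S2 * u] to first order. The mean
    value inequality then applies. *)
Lemma quadratic_estimate (t S2 : R[i]) : regular t -> logder t = 0 ->
  (fun N => (\sum_(n < N) sres n t ^+ 2 : C)) @ \oo --> (S2 : C) ->
  exists C0 d : R, [/\ 0 <= C0, 0 < d &
    forall (rho : R) (u v : R[i]), rho <= d -> normc u <= rho -> normc v <= rho ->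
    normc (f (t + u) - f (t + v) - - (f t * S2 / 2) * ((u - v) * (u + v)) : R[i]) <=
    C0 * rho ^+ 2 * normc (u - v)].
Proof.
move=> rt L0 HS; have [d [K [d0 K0 H]]] := expansion r2 flim rt.
set F := normc (f t); have F0 : 0 <= F := normc_ge0 _.
pose Phi := F * (1 + K * d ^+ 2).
have Phi0 : 0 <= Phi by rewrite mulr_ge0 // addr_ge0 // mulr_ge0 // sqr_ge0.
have fu u : normc u <= d -> normc (f (t + u) - f t : R[i]) <= K * normc u ^+ 2 * F.
  move=> ud; have [|_ _ _ /(_ u ud)] := H 0; first by rewrite normc0 ltW.
  by rewrite addr0 L0 mul0r addr0 mulr1.
have fPhi u : normc u <= d -> normc (f (t + u)) <= Phi.
  move=> ud; have := normcD_le (f (t + u) - f t : R[i]) (f t); rewrite subrK => /le_trans; apply.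
  rewrite /Phi -/F mulrDr mulr1 addrC lerD2l; apply: le_trans (fu u ud) _.
  rewrite mulrC; apply: ler_wpM2l => //; apply: ler_wpM2l => //.
  by rewrite ler_pXn2r ?nnegrE ?normc_ge0 // ltW.
pose g : R[i] := f t * S2 / 2.
pose Hf u : R[i] := f (t + u) + g * u ^+ 2.
pose Hd u : R[i] := f (t + u) * logder (t + u) + 2 * g * u.
pose S := normc S2; have S0 : 0 <= S := normc_ge0 _.
pose C0 := K * (Phi + S * d * F).
have C00 : 0 <= C0 by rewrite !mulr_ge0 // addr_ge0 // !mulr_ge0 // ltW.
exists C0, d; split=> // rho u v rd ur vr.
have -> : f (t + u) - f (t + v) - - (f t * S2 / 2) * ((u - v) * (u + v)) = Hf u - Hf v :> R[i].
  by rewrite /Hf -/g; ring.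
apply: (@mean_value R Hf Hd rho (C0 * rho ^+ 2) (K * Phi + normc g) d d0) => // x.
- move=> xr; have xd := le_trans xr rd; have n0 := normc_ge0 x.
  have [_ _ /(_ S2 HS) h2 _] := H x xd; rewrite L0 subr0 in h2.
  have -> : Hd x = f (t + x) * (logder (t + x) + S2 * x) + S2 * x * (f t - f (t + x)) :> R[i].
    by rewrite /Hd /g; field.
  apply: le_trans (normcD_le _ _) _; rewrite !normcM normcB_sym -/S.
  have e1 : normc (f (t + x)) * normc (logder (t + x) + S2 * x) <= Phi * (K * normc x ^+ 2).
    by apply: ler_pM; rewrite ?normc_ge0 ?fPhi.
  have e2 : S * normc x * normc (f (t + x) - f t : R[i]) <= S * d * (K * normc x ^+ 2 * F).
    apply: ler_pM; rewrite ?normc_ge0 ?mulr_ge0 ?normc_ge0 ?fu //.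
    exact: ler_wpM2l.
  apply: (@le_trans _ _ (C0 * normc x ^+ 2)).
    apply: le_trans (lerD e1 e2) _.
    by rewrite le_eqVlt; apply/orP; left; apply/eqP; rewrite /C0; ring.
  by apply: ler_wpM2l => //; rewrite ler_pXn2r ?nnegrE ?(le_trans n0).
- move=> h xr hd; have xd := le_trans xr rd.
  have [_ _ _ /(_ h hd) h2] := H x xd.
  have -> : Hf (x + h) - Hf x - Hd x * h =
     (f (t + x + h) - f (t + x) * (1 + logder (t + x) * h)) + g * h ^+ 2 :> R[i].
    by rewrite /Hf /Hd (addrA t x h); ring.
  apply: le_trans (normcD_le _ _) _; rewrite (normcM g) normcX mulrDl lerD2r.
  apply: le_trans h2 _; rewrite mulrAC; apply: ler_wpM2r; first exact: sqr_ge0.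
  by apply: ler_wpM2l => //; exact: fPhi.
Qed.

Hypothesis fE : entire f.

(** At a real point every [sres n t ^+ 2] is a nonnegative real and the k-th is positive, so their
    sum [S2], and with it the quadratic coefficient, is nonzero. *)
Lemma simple_critical_FixAut (t : R) k : zq k != 0 -> regular t%:C -> logder t%:C = 0 ->
  FixAut f t%:C.
Proof.
move=> qk rt L0.
have [|S2 HS] := @abs_bsum_cvg R (fun n => sres n t%:C ^+ 2).
  by under eq_fun do rewrite normcX; exact: sres_bsum.
have S20 : S2 != 0.
  have sk : 0 < rsres k t ^+ 2.
    rewrite exprn_even_gt0 //= /rsres mulf_neq0 // invr_neq0 //.
    by have := rt k; rewrite lin_real fmorph_eq0.
  suff : rsres k t ^+ 2 <= complex.Re S2.
    by move=> h; apply/eqP => S20; move: h; rewrite S20 /=; lra.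
  apply: (cvgr_to_ge (cvg_Re HS)); exists k.+1 => // N /= kN.
  rewrite (Re_sum (fun n => sres n t%:C ^+ 2)).
  rewrite (eq_bigr (fun n : 'I_N => rsres n t ^+ 2)) => [|i _]; last first.
    by rewrite sres_real -rmorphXn.
  by rewrite (bigD1 (Ordinal kN)) //= lerDl sumr_ge0 // => i _; exact: sqr_ge0.
have [C0 [d [C00 d0 Q]]] := quadratic_estimate rt L0 HS.
set a : R[i] := - (f t%:C * S2 / 2) in Q.
have a0 : a != 0.
  rewrite oppr_eq0 !mulf_neq0 ?invr_neq0 ?pnatr_eq0 //.
  exact: (regular_neq0 r2 c0 flim).
have A0 : 0 < normc a by rewrite normc_gt0.
have K0 : 0 < 32 * (C0 + 1) by lra.
apply: (@quadratic_point_FixAut R f t%:C a C0 d fE a0 C00 Q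
  (Num.min (d / 2) (normc a / (32 * (C0 + 1))))).
- by rewrite lt_min !divr_gt0.
- by rewrite ge_min lexx.
- by rewrite -ler_pdivlMr // ge_min lexx orbT.
Qed.

(** Otherwise [logder t] is a nonzero real, and a short real step in the direction of its sign
    increases the modulus to first order. *)
Lemma modulus_max_critical (x y t : R) : complex.Im b = 0 -> regular t%:C -> x < t < y ->
  (forall s, x <= s <= y -> normc (f s%:C) <= normc (f t%:C)) -> logder t%:C = 0.
Proof.
move=> b0 rt /andP[xt ty] tmax.
have [d [K [d0 K0 H]]] := expansion r2 flim rt.
have [|_ _ _] := H 0; first by rewrite normc0 ltW.
rewrite addr0 => {}H.
have I0 : complex.Im (logder t%:C) = 0 by rewrite (Im_logder_real b r2 rt).
have F0 : 0 < normc (f t%:C) by rewrite normc_gt0; exact: (regular_neq0 r2 c0 flim).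
have LE : logder t%:C = (complex.Re (logder t%:C))%:C.
  by case: (logder t%:C) I0 => ? ? /= ->.
rewrite LE in H *; move: (complex.Re _) H => l H {LE I0}.
suff -> : l = 0 by [].
apply/eqP/negPn/negP => l0.
have l1 : 0 < `|l| by rewrite normr_gt0.
have K1 : 0 < K + 1 by lra.
(* The step is short enough for the expansion, stays in the interval, and makes the quadratic error
   smaller than the linear gain. *)
pose k := Num.min (Num.min d (1 / (`|l| + 1))) (Num.min (Num.min (t - x) (y - t)) (`|l| / (K + 1) / 2)).
have L1 : 0 < `|l| + 1 by lra.
have k0 : 0 < k by rewrite !lt_min d0 !subr_gt0 xt ty !divr_gt0.
have : k <= k by [].
rewrite {2}/k !le_min => /andP[/andP[kd kl] /andP[/andP[kx ky] kK]].
pose h := Num.sg l * k.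
have lh : l * h = `|l| * k by rewrite /h mulrA [l * _]mulrC -normrEsg.
have nh : `|h| = k by rewrite normrM normr_sg l0 mul1r gtr0_norm.
have hk : - k <= h <= k by rewrite -ler_norml nh.
have hx : x <= t + h <= y by lra.
have := H h%:C; rewrite normc_real nh -rmorphD => /(_ kd) E.
have E' : normc (f t%:C * (1 + l%:C * h%:C)) - normc (f (t + h)%:C) <= K * k ^+ 2 * normc (f t%:C).
  by apply: le_trans (normcB_ge _ _) _; rewrite normcB_sym.
rewrite -rmorphM -(rmorph1 (real_complex R)) -rmorphD (normcM (f t%:C)) normc_real lh in E'.
rewrite ger0_norm in E'; last by have := mulr_gt0 l1 k0; lra.
have h2 := tmax _ hx.
have : normc (f t%:C) * (`|l| * k) <= normc (f t%:C) * (K * k ^+ 2).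
  by rewrite mulrDr mulr1 in E'; lra.
rewrite ler_pM2l // expr2 mulrA ler_pM2r // => h3.
rewrite mulrAC ler_pdivlMr // in kK; nra.
Qed.

End LaguerrePolya.

(** * Fixed points of branches and zeros of [f] *)

Section FixedPoints.
Variables (R : realType) (m : nat) (r : nat -> R) (c b : R[i]).
Local Notation C := ((R[i])^o).
Implicit Types (z w : R[i]).

Local Notation zq := (zq m r).
Local Notation regular := (regular m r).
Local Notation logder := (logder m r b).

Hypothesis r2 : bsum (fun n => r n ^+ 2).
Hypothesis c0 : c != 0.
Variable f : C -> C.
Hypothesis flim : forall z : R[i], (fun N => (cprod m r c b N z : C)) @ \oo --> (f z : C).
Hypothesis fE : entire f.
Hypothesis fnc : exists z w : C, f z != f w.
Hypothesis fZ : forall z : C, f z = 0 -> complex.Im z = 0.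
Hypothesis fR : forall x : R, complex.Im (f x%:C) = 0.

Lemma Im_exponent : complex.Im b = 0.
Proof.
have [x [y [_ xy _ H]]] := regular_interval m r2 (ltr01 : (0 : R) < 1).
have rx : regular x%:C by apply: H; rewrite lexx ltW.
by rewrite -(Im_logder_real b r2 rx); exact: (Im_logder_eq0 r2 c0 flim fR rx).
Qed.

(** Without zeros [f] is [c] times the exponential of [b * z] and [logder] is [b]; [b = 0] would
    make [f] constant. *)
Lemma zero_or_exponential :
  (exists k, zq k != 0) \/ (forall w, logder w != 0).
Proof.
have [[k qk]|nq] := pselect (exists k, zq k != 0); [by left; exists k|right=> w].
have q0 k : zq k = 0 by apply/eqP/negPn/negP => qk; apply: nq; exists k.
have [fexp ->] := no_zeros r2 flim q0.
apply/eqP => b0; have [z [z' /eqP]] := fnc; apply.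
by rewrite !fexp b0 !mul0r.
Qed.

Lemma inj_at_noncritical w : regular w -> logder w != 0 -> inj_at f w.
Proof. exact: (local_injective r2 c0 flim). Qed.

Lemma inj_at_nonreal w : complex.Im w != 0 -> inj_at f w.
Proof.
move=> w0.
have rw : regular w.
  by apply: (neq0_regular flim); apply: contraNneq w0 => /fZ ->.
apply: inj_at_noncritical => //.
case: zero_or_exponential => [[k qk]|//].
exact: (logder_nonreal r2 Im_exponent qk rw w0).
Qed.

(** On a regular interval [logder] cannot vanish at both ends: it is strictly decreasing when [f]
    has zeros and never 0 otherwise. *)
Lemma inj_at_real_dense (x y : R) : x < y -> exists2 t, x < t < y & inj_at f t%:C.
Proof.
move=> xy; have [x1 [y1 [h1 h2 h3 H]]] := regular_interval m r2 xy.
have rx : regular x1%:C by apply: H; rewrite lexx ltW.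
have ry : regular y1%:C by apply: H; rewrite lexx ltW.
have [Lx|Lx] := eqVneq (logder x1%:C) 0; last first.
  by exists x1; [lra|exact: inj_at_noncritical].
exists y1; [lra|apply: inj_at_noncritical => //].
case: zero_or_exponential => [[k qk]|//].
have := logder_decr b r2 h2 qk H; rewrite Lx => h.
by apply/eqP => Ly; move: h; rewrite Ly ltxx.
Qed.

Lemma FixAut_not_inj w : FixAut f w -> ~ inj_at f w.
Proof.
move=> [D [phi [br Dw [z Dz /eqP pz] pw]]] iw; apply: pz.
exact: (branch_id inj_at_nonreal inj_at_real_dense br Dw pw iw).
Qed.

Lemma FixAut_real w : FixAut f w -> complex.Im w = 0.
Proof.
move=> /FixAut_not_inj nw; apply/eqP/negPn/negP => w0.
exact: nw (inj_at_nonreal w0).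
Qed.

(** Without a zero of [f] on the interval, [logder] would vanish at [x] and at [y], against strict
    monotonicity or, for the exponential, against nonvanishing. *)
Lemma FixAut_separated (x y : R) : x < y -> FixAut f x%:C -> FixAut f y%:C ->
  exists2 t : R, x <= t <= y & f t%:C = 0.
Proof.
move=> xy /FixAut_not_inj nx /FixAut_not_inj ny; apply: contrapT => nt.
have H t : x <= t <= y -> regular t%:C.
  by move=> xty; apply: (neq0_regular flim); apply/eqP => ft; apply: nt; exists t.
have rx : regular x%:C by apply: H; rewrite lexx ltW.
have ry : regular y%:C by apply: H; rewrite lexx ltW.
have Lx : logder x%:C = 0.
  by apply/eqP/negPn/negP => L; apply: nx; exact: inj_at_noncritical.
have Ly : logder y%:C = 0.
  by apply/eqP/negPn/negP => L; apply: ny; exact: inj_at_noncritical.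
case: zero_or_exponential => [[k qk]|/(_ x%:C)]; last by rewrite Lx eqxx.
by have := logder_decr b r2 xy qk H; rewrite Lx Ly ltxx.
Qed.

(** The modulus vanishes at both ends but not throughout, so it has a positive interior maximum;
    there [logder] is 0 and [f] is quadratic to leading order. *)
Lemma zeros_separated (x y : R) : x < y -> f x%:C = 0 -> f y%:C = 0 ->
  exists2 t : R, x < t < y & FixAut f t%:C.
Proof.
move=> xy fx fy.
have cf : {within `[x, y], continuous (fun t : R => normc (f t%:C))}.
  apply: continuous_subspaceT => s; apply/cvgrPdist_lt => e e0.
  have [d d0 Hd] := derivable_cont (@fE s%:C) e0.
  apply/nbhs_ballP; exists d => // u; rewrite /ball /= distrC => us.
  have := Hd u%:C; rewrite -rmorphB normc_real => /(_ us) h.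
  rewrite ltr_norml; have := normcB_ge (f u%:C) (f s%:C); have := normcB_ge (f s%:C) (f u%:C).
  rewrite (normcB_sym (f s%:C)); lra.
have [t] := EVT_max (ltW xy) cf; rewrite in_itv /= => /andP[xt ty] tmax.
have [x1 [y1 [h1 h2 h3 H]]] := regular_interval m r2 xy.
have ft : 0 < normc (f t%:C).
  have : 0 < normc (f x1%:C).
    rewrite normc_gt0; apply: (regular_neq0 r2 c0 flim).
    by apply: H; rewrite lexx ltW.
  by move=> /lt_le_trans; apply; apply: tmax; rewrite in_itv /=; lra.
have xt' : x < t.
  by rewrite lt_def xt andbT; apply/eqP => tx; move: ft; rewrite tx fx normc0 ltxx.
have ty' : t < y.
  by rewrite lt_def ty andbT; apply/eqP => tx; move: ft; rewrite -tx fy normc0 ltxx.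
have rt : regular t%:C by apply: (neq0_regular flim); rewrite -normc_gt0.
have xty : x < t < y by rewrite xt' ty'.
have Lt : logder t%:C = 0.
  apply: (modulus_max_critical r2 c0 flim Im_exponent rt xty) => s sxy.
  by apply: tmax; rewrite in_itv.
exists t => //; case: zero_or_exponential => [[k qk]|/(_ t%:C)]; last by rewrite Lt eqxx.
exact: (simple_critical_FixAut r2 c0 flim fE qk rt Lt).
Qed.

End FixedPoints.

(** * Reduction to a product with real zeros, and the theorem *)

(** Each nonzero [r n] is real because its inverse is a zero of [f]: the n-th factor makes all later
    partial products vanish there. *)
Lemma genus_le1_real_product (R : realType) (f : (R[i])^o -> (R[i])^o) :
  (forall z : (R[i])^o, f z = 0 -> complex.Im z = 0) -> genus_le1 f ->
  exists (c b : R[i]) (m : nat) (r : nat -> R), [/\ c != 0, bsum (fun n => r n ^+ 2) &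
    forall z : R[i], (fun N => (cprod m r c b N z : (R[i])^o)) @ \oo --> (f z : (R[i])^o)].
Proof.
move=> fZ [c [b [m [r [c0 [r2 flim]]]]]].
have rR n : r n = (complex.Re (r n))%:C.
  have [->//|rn0] := eqVneq (r n) 0.
  have fz : f (r n)^-1 = 0.
    apply/eqP; rewrite -normc_eq0; apply/eqP/le_anti; rewrite normc_ge0 andbT.
    apply: (cvgr_to_le (cvg_normc (flim (r n)^-1))); exists n.+1 => // N /= nN.
    by rewrite (bigD1 (Ordinal nN)) //= divff // subrr !(mul0r, mulr0) normc0.
  have := fZ _ fz; case: (r n) rn0 => x y /= rn0 /eqP.
  rewrite oppr_eq0 mulf_eq0 invr_eq0 => /orP[/eqP->//|].
  rewrite paddr_eq0 ?sqr_ge0 // !sqrf_eq0 => /andP[/eqP x0 /eqP y0].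
  by rewrite x0 y0 eqxx in rn0.
exists c, b, m, (fun n => complex.Re (r n)); split=> //.
- set u := (fun n => _) in r2.
  have u0 n : 0 <= u n by rewrite addr_ge0 ?sqr_ge0.
  exists (limn (series u)) => N; apply: (@le_trans _ _ (series u N)).
    by rewrite /series /= big_mkord; apply: ler_sum => n _; rewrite lerDl sqr_ge0.
  apply: nondecreasing_cvgn_le => //.
  by apply/nondecreasing_seqP => k; rewrite /series /= big_nat_recr //= lerDl.
(* The [m] factors [z] are counted among the indices of [cprod], hence the shift by [m]. *)
- move=> z; rewrite -(cvg_shiftn m); have := flim z.
  rewrite (_ : (fun N => _) = [sequence (cprod m (fun n => complex.Re (r n)) c b (n + m) z : (R[i])^o)]_n) //.
  apply/funext => N /=; rewrite addnC cprodE; congr (_ * _).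
  by apply: eq_bigr => n _; rewrite -rR.
Qed.

Theorem theorem5 (R : realType) (f : (R[i])^o -> (R[i])^o) :
  entire f ->
  (exists z w : (R[i])^o, f z != f w) ->
  (forall z : (R[i])^o, f z = 0 -> complex.Im z = 0) ->
  genus_le1 f ->
  (forall x : R, complex.Im (f x%:C) = 0) ->
  [/\ (forall w : (R[i])^o, FixAut f w -> complex.Im w = 0),
      (forall x y : R, x < y -> FixAut f x%:C -> FixAut f y%:C ->
         exists2 t : R, x <= t <= y & f t%:C = 0)
    & (forall x y : R, x < y -> f x%:C = 0 -> f y%:C = 0 ->
         exists2 t : R, x < t < y & FixAut f t%:C)].
Proof.
move=> fE fnc fZ gf fR.
have [c [b [m [r [c0 r2 flim]]]]] := genus_le1_real_product fZ gf.
split.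
- exact: (FixAut_real r2 c0 flim fnc fZ fR).
- exact: (FixAut_separated r2 c0 flim fnc fZ fR).
- exact: (zeros_separated r2 c0 flim fE fnc fR).
Qed.
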